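(* Let $\Phi$ be an entanglement breaking channel and let $\Omega$ be an arbitrary channel (completely positive trace-preserving map between finite-dimensional matrix algebras). Then for every $p \geq 1$, $$\nu_p(\Phi \otimes \Omega) = \nu_p(\Phi)\,\nu_p(\Omega).$$
   Context: An entanglement breaking channel is a map of the form $\Phi(\rho) = \sum_{k=1}^K R_k \,\mathrm{Tr}(X_k \rho)$, where each $R_k$ is a density matrix (positive semidefinite, trace one) and $\{X_k\}$ is a POVM, i.e. $X_k \geq 0$ and $\sum_k X_k = I$. For a matrix $A$ and $p \geq 1$, $\|A\|_p = (\mathrm{Tr}|A|^p)^{1/p}$. The maximal $p$-norm of a channel $\Omega$ is $\nu_p(\Omega) = \sup_\rho \|\Omega(\rho)\|_p$, the supremum over density matrices $\rho$ in the domain of $\Omega$. *)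

(* Defs.v *)
From HB Require Import structures.
From mathcomp Require Import all_boot all_order all_algebra.
From mathcomp Require Import mxpoly.
From mathcomp Require Import classical_sets boolp reals exp.
From mathcomp Require Import complex mxtens.

Set Implicit Arguments.
Unset Strict Implicit.
Unset Printing Implicit Defensive.
Import Order.TTheory GRing.Theory Num.Theory.
Local Open Scope ring_scope.
Local Open Scope classical_set_scope.

Section QInfo.
Variable R : realType.
Local Notation C := R[i].

Definition adjmx {m n : nat} (A : 'M[C]_(m, n)) : 'M[C]_(n, m) :=
  \matrix_(i, j) (A j i)^*.

Definition psd {n : nat} (A : 'M[C]_n) : Prop :=
  forall x : 'cV[C]_n, 0 <= (adjmx x *m A *m x) 0 0.

Definition density {n : nat} (rho : 'M[C]_n) : Prop :=
  psd rho /\ \tr rho = 1.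

Definition eigenvalues {n : nat} (M : 'M[C]_n) : seq C :=
  sval (closed_field_poly_normal (char_poly M)).

(* Schatten p-norm: ||A||_p = (Tr |A|^p)^(1/p), where |A| = (A^* A)^(1/2),
   so Tr |A|^p = sum of lambda^(p/2) over the eigenvalues lambda of A^* A
   (which are real and nonnegative). *)
Definition schatten (p : R) {n : nat} (A : 'M[C]_n) : R :=
  powR (\sum_(z <- eigenvalues (adjmx A *m A)) powR (complex.Re z) (p / 2))
       (p^-1).

(* tensor product F (x) G of linear maps between matrix algebras, defined on
   the product basis E_ij (x) E_kl and extended linearly *)
Definition tensmap {n1 m1 n2 m2 : nat}
  (F : 'M[C]_n1 -> 'M[C]_m1) (G : 'M[C]_n2 -> 'M[C]_m2)
  (X : 'M[C]_(n1 * n2)) : 'M[C]_(m1 * m2) :=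
  \sum_(i < n1) \sum_(j < n1) \sum_(k < n2) \sum_(l < n2)
    X (mxtens_index (i, k)) (mxtens_index (j, l)) *:
      (F (delta_mx i j) *t G (delta_mx k l)).

Definition is_linear_map {n m : nat} (F : 'M[C]_n -> 'M[C]_m) : Prop :=
  forall (a : C) (X Y : 'M[C]_n), F (a *: X + Y) = a *: F X + F Y.

Definition completely_positive {n m : nat} (F : 'M[C]_n -> 'M[C]_m) : Prop :=
  forall (k : nat) (X : 'M[C]_(k * n)),
    psd X -> psd (tensmap (fun Y : 'M[C]_k => Y) F X).

Definition trace_preserving {n m : nat} (F : 'M[C]_n -> 'M[C]_m) : Prop :=
  forall X : 'M[C]_n, \tr (F X) = \tr X.

Definition channel {n m : nat} (F : 'M[C]_n -> 'M[C]_m) : Prop :=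
  [/\ is_linear_map F, completely_positive F & trace_preserving F].

Definition entanglement_breaking {n m : nat} (Phi : 'M[C]_n -> 'M[C]_m) : Prop :=
  exists (K : nat) (Rk : 'I_K -> 'M[C]_m) (Xk : 'I_K -> 'M[C]_n),
    [/\ forall k, density (Rk k),
        forall k, psd (Xk k),
        \sum_(k < K) Xk k = 1%:M &
        forall rho : 'M[C]_n, Phi rho = \sum_(k < K) \tr (Xk k *m rho) *: Rk k].

Definition max_pnorm (p : R) {n m : nat} (Om : 'M[C]_n -> 'M[C]_m) : R :=
  sup [set schatten p (Om rho) | rho in [set rho : 'M[C]_n | density rho]].

End QInfo.

(* Main.v *)
Require Import Defs.
From HB Require Import structures.
From mathcomp Require Import all_boot all_order all_algebra.
From mathcomp Require Import spectral.
From mathcomp Require Import classical_sets boolp reals exp.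
From mathcomp Require Import filter topology normedtype sequences.
From mathcomp Require Import complex mxtens.
From mathcomp Require Import ring lra.
Set Implicit Arguments.
Unset Strict Implicit.
Unset Printing Implicit Defensive.
Import Order.TTheory GRing.Theory Num.Theory.
Import numFieldNormedType.Exports.
Local Open Scope ring_scope.

(** Let [S = Phi(rho_1)] with [rho_1] the first marginal of [rho].  Then
    [(Phi (x) Om)(rho)] has the form [Y = \sum_k A_k (x) B_k] with [A_k, B_k >= 0],
    [\sum_k A_k = S] and [||B_k||_p <= c := nu_p(Om)], so it is enough to show
    [||Y||_p <= c ||S||_p].

    Put [Z = Y^p] and let [Z_1] be its partial trace over the second factor.
    Interpolating, in the parameter [1/p], between
    [Tr Z (a a^* (x) 1) = <a, Z_1 a>] and
    [Tr (a a^* (x) (B_k/c)^p) <= <a, a>] gives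
    [Tr Y^(p-1) (a a^* (x) B_k) <= c <a, Z_1^(1-1/p) a>].
    Summing over the eigenvectors [a] of the [A_k],
    [Tr Y^p <= c Tr (S Z_1^(1-1/p)) <= c ||S||_p (Tr Y^p)^(1-1/p)]
    by Hoelder's inequality. *)

(** The interpolation uses no complex analysis. In eigenbases each endpoint bound compares a sum of
    weighted squared moduli of fixed linear forms with a diagonal quadratic form; only the weights
    depend on the parameter, and they do so geometrically. The valid parameters contain 0 and 1,
    form a closed set and are stable under midpoints (an AM-GM argument on eigenvectors), so they
    fill the interval. The midpoint step divides by the diagonal weights. The eigenvalues of Z_1 may
    vanish, so they are shifted by some e > 0, which is removed at the end. At p = 1 the parameter
    1/p is itself an endpoint and a trace computation takes over. The reverse inequality of the
    theorem comes from product inputs. *)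

Local Notation Re := complex.Re.
Local Notation Im := complex.Im.

(* A copy of [real_complex] with a single instance path from [realType], so
   that rewriting under it does not depend on how [R] is seen as a ring. *)
Definition cplx (R : realType) (r : R) : R[i] := Complex r 0.
Arguments cplx : simpl never.
HB.instance Definition _ (R : realType) :=
  GRing.RMorphism.copy (@cplx R) (real_complex R).
Local Notation "r %:C" := (cplx r) (format "r %:C") : ring_scope.

(** * Quadratic forms and spectral decomposition of positive matrices *)

Section HilbertSpace.
Variable R : realType.
Local Notation C := R[i].

Lemma cplxI : injective (@cplx R). Proof. by move=> x y []. Qed.

Lemma ler_cplx (x y : R) : (x%:C <= y%:C) = (x <= y).
Proof. exact: lecR. Qed.

Definition nsq (z : C) : R := Re z ^+ 2 + Im z ^+ 2.

Lemma nsqE (z : C) : (nsq z)%:C = z^* * z.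
Proof. by rewrite mulrC -normCK -add_Re2_Im2. Qed.

Lemma nsq_ge0 z : 0 <= nsq z.
Proof. by rewrite addr_ge0 ?sqr_ge0. Qed.

Lemma nsq0 : nsq 0 = 0.
Proof. by rewrite /nsq /= expr0n addr0. Qed.

Lemma nsq_eq0 z : (nsq z == 0) = (z == 0).
Proof.
apply/eqP/eqP => [h|->]; last exact: nsq0.
have := nsqE z; rewrite h => /esym/eqP.
by rewrite mulf_eq0 conjC_eq0 orbb => /eqP.
Qed.

Lemma nsqM z w : nsq (z * w) = nsq z * nsq w.
Proof.
apply: cplxI; rewrite rmorphM /= !nsqE rmorphM /=; ring.
Qed.

Lemma nsq_conj (z : C) : nsq (z^*) = nsq z.
Proof. by apply: cplxI; rewrite !nsqE conjCK mulrC. Qed.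

Lemma nsq_real (r : R) : nsq (r%:C) = r ^+ 2.
Proof. by rewrite /nsq /= expr0n addr0. Qed.

Lemma conjC_real (r : R) : (r%:C)^* = r%:C.
Proof. by rewrite -[LHS]/(conjc _) conjc_real. Qed.

Lemma ge0_Re (z : C) : 0 <= z -> z = (Re z)%:C.
Proof. by move=> z0; rewrite -[RHS]/(real_complex R _) RRe_real // ger0_real. Qed.

Lemma Re_ge0 (z : C) : 0 <= z -> 0 <= Re z.
Proof. by rewrite lecE => /andP[]. Qed.

Lemma Re_sum (I : Type) (r : seq I) (P : pred I) (F : I -> C) :
  Re (\sum_(i <- r | P i) F i) = \sum_(i <- r | P i) Re (F i).
Proof.
by apply: (big_ind2 (fun x y => Re x = y)) => // -[? ?] a [? ?] b <- <-.
Qed.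

Lemma Re_cplxM (r : R) (z : C) : Re (r%:C * z) = r * Re z.
Proof. by case: z => a b /=; rewrite mul0r subr0. Qed.

Lemma adjmxK m n (A : 'M[C]_(m, n)) : adjmx (adjmx A) = A.
Proof. by apply/matrixP => i j; rewrite !mxE conjCK. Qed.

Lemma adjmxM m n p (A : 'M[C]_(m, n)) (B : 'M[C]_(n, p)) :
  adjmx (A *m B) = adjmx B *m adjmx A.
Proof.
apply/matrixP => i j; rewrite !mxE rmorph_sum /=; apply: eq_bigr => k _.
by rewrite !mxE rmorphM mulrC.
Qed.

Lemma adjmxD m n (A B : 'M[C]_(m, n)) : adjmx (A + B) = adjmx A + adjmx B.
Proof. by apply/matrixP => i j; rewrite !mxE rmorphD. Qed.

Lemma adjmxZ m n c (A : 'M[C]_(m, n)) : adjmx (c *: A) = c^* *: adjmx A.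
Proof. by apply/matrixP => i j; rewrite !mxE rmorphM. Qed.

Lemma adjmx_delta m n i j : adjmx (delta_mx i j : 'M[C]_(m, n)) = delta_mx j i.
Proof. by apply/matrixP => k l; rewrite !mxE conjC_nat andbC. Qed.

Lemma adjmx1 n : adjmx (1%:M : 'M[C]_n) = 1%:M.
Proof. by apply/matrixP => k l; rewrite !mxE conjC_nat eq_sym. Qed.

Lemma adjmx_tens m n p q (A : 'M[C]_(m, n)) (B : 'M[C]_(p, q)) :
  adjmx (A *t B) = adjmx A *t adjmx B.
Proof. by apply/matrixP => i j; rewrite !mxE rmorphM. Qed.

Definition qform n (A : 'M[C]_n) (x : 'cV[C]_n) : C :=
  (adjmx x *m A *m x) 0 0.

Lemma qformD n (A B : 'M[C]_n) x : qform (A + B) x = qform A x + qform B x.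
Proof. by rewrite /qform mulmxDr mulmxDl mxE. Qed.

Lemma qformZ n c (A : 'M[C]_n) x : qform (c *: A) x = c * qform A x.
Proof. by rewrite /qform -scalemxAr -scalemxAl mxE. Qed.

Lemma qform0 n x : qform (0 : 'M[C]_n) x = 0.
Proof. by rewrite /qform mulmx0 mul0mx mxE. Qed.

Lemma qform_sum n (I : Type) (r : seq I) (P : pred I) (F : I -> 'M[C]_n) x :
  qform (\sum_(i <- r | P i) F i) x = \sum_(i <- r | P i) qform (F i) x.
Proof.
by apply: (big_morph (@qform n ^~ x)) => [A B|]; rewrite (qformD, qform0).
Qed.

Lemma qform_congr m n (A : 'M[C]_n) (T : 'M[C]_(m, n)) x :
  qform (T *m A *m adjmx T) x = qform A (adjmx T *m x).
Proof. by rewrite /qform adjmxM adjmxK !mulmxA. Qed.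

(** Polarization: the vectors e_i, e_i + e_j and e_i + 'i e_j already determine all entries. Over
    the complex numbers this requires no symmetry of [B], which is what lets self-adjointness be
    deduced from [psd]. *)
Lemma qform_eq0 n (B : 'M[C]_n) : (forall x, qform B x = 0) -> B = 0.
Proof.
move=> B0.
have Bij i j (w : C) : B i i + w^* * w * B j j + w * B i j + w^* * B j i = 0.
  have E (k l : 'I_n) : delta_mx 0 k *m B *m (delta_mx l 0 : 'cV_n) = (B k l)%:M.
    by rewrite -rowE -colE; apply/matrixP => u v; rewrite !mxE !ord1.
  have := B0 (delta_mx i 0 + w *: delta_mx j 0).
  rewrite /qform adjmxD adjmxZ !adjmx_delta !mulmxDl !mulmxDr.
  rewrite -!scalemxAl -!scalemxAr !E !mxE !mulr1n => <-; ring.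
have Bd i : B i i = 0 by have := Bij i i 0; rewrite rmorph0 !mul0r !addr0.
apply/matrixP => i j; apply/eqP; rewrite [in X in _ == X]mxE.
have := Bij i j 1; have := Bij i j 'i.
rewrite !Bd rmorph1 conjCi !mulr0 !mul1r !add0r mulNr => /eqP.
rewrite subr_eq0 => /eqP/(mulfI (neq0Ci _)) <- /eqP.
by rewrite -mulr2n mulrn_eq0.
Qed.

Lemma qform_real_hermitian n (A : 'M[C]_n) :
  (forall x, qform A x \is Num.real) -> adjmx A = A.
Proof.
move=> Areal; apply/eqP; rewrite eq_sym -subr_eq0; apply/eqP.
apply: qform_eq0 => x; rewrite qformD -scaleN1r qformZ mulN1r.
have -> : qform (adjmx A) x = (qform A x)^*.
  have -> : (qform A x)^* = adjmx (adjmx x *m A *m x) 0 0 by rewrite [RHS]mxE.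
  by rewrite !adjmxM adjmxK mulmxA.
by rewrite (CrealP (Areal x)) subrr.
Qed.

Definition spmx n (V : 'M[C]_n) (d : 'I_n -> R) : 'M[C]_n :=
  V *m diag_mx (\row_k (d k)%:C) *m adjmx V.

Lemma qform_diag n (d : 'I_n -> R) x :
  qform (diag_mx (\row_k (d k)%:C)) x = (\sum_k d k * nsq (x k 0))%:C.
Proof.
rewrite /qform mxE rmorph_sum; apply: eq_bigr => k _.
by rewrite mul_mx_diag !mxE rmorphM /= nsqE; ring.
Qed.

Lemma qform_spmx n (V : 'M[C]_n) d x :
  qform (spmx V d) x = (\sum_k d k * nsq ((adjmx V *m x) k 0))%:C.
Proof. by rewrite qform_congr qform_diag. Qed.

Lemma qform1 n (x : 'cV[C]_n) : qform 1%:M x = (\sum_k nsq (x k 0))%:C.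
Proof.
rewrite /qform mulmx1 mxE rmorph_sum; apply: eq_bigr => k _.
by rewrite !mxE -nsqE.
Qed.

Lemma parseval n (V : 'M[C]_n) (x : 'cV[C]_n) : V *m adjmx V = 1%:M ->
  \sum_k nsq ((adjmx V *m x) k 0) = \sum_k nsq (x k 0).
Proof.
by move=> VV; apply: cplxI; rewrite -!qform1 -qform_congr mulmx1 VV.
Qed.

Lemma psd_spmx n (V : 'M[C]_n) d : (forall k, 0 <= d k) -> psd (spmx V d).
Proof.
move=> d0 x; rewrite -/(qform _ _) qform_spmx ler_cplx.
by apply: sumr_ge0 => k _; rewrite mulr_ge0 ?nsq_ge0.
Qed.

Lemma psd_spectral n (A : 'M[C]_n) : psd A ->
  exists (V : 'M[C]_n) (d : 'I_n -> R),
    [/\ V *m adjmx V = 1%:M, forall k, 0 <= d k & A = spmx V d].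
Proof.
move=> Apsd.
have Ah : adjmx A = A.
  by apply: qform_real_hermitian => x; rewrite ger0_real // Apsd.
have adjE m (B : 'M[C]_m) : map_mx Num.conj B^T = adjmx B.
  by apply/matrixP => i j; rewrite !mxE.
have An : A \is normalmx by apply/normalmxP; rewrite adjE Ah.
pose P := spectralmx A; pose s := spectral_diag A.
have PU : P *m adjmx P = 1%:M.
  by rewrite -adjE; apply/unitarymxP; exact: spectral_unitarymx.
have PU' := mulmx1C PU.
have As : A = adjmx P *m diag_mx s *m P.
  have /orthomx_spectralP E := An; apply: (etrans E).
  congr (_ *m _ *m _).
  by rewrite invmx_unitary ?spectral_unitarymx // adjE.
(* Each eigenvalue is the value of the form of [A] at the corresponding eigenvector. *)
have s0 k : 0 <= s 0 k.
  have <- : qform (diag_mx s) (delta_mx k 0) = s 0 k.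
    by rewrite /qform adjmx_delta -rowE -colE !mxE eqxx mulr1n.
  have -> : diag_mx s = P *m A *m adjmx P.
    by rewrite As !mulmxA PU mul1mx -mulmxA PU mulmx1.
  by rewrite qform_congr; apply: Apsd.
exists (adjmx P), (fun k => Re (s 0 k)); split.
- by rewrite adjmxK.
- by move=> k; apply: Re_ge0.
- rewrite /spmx adjmxK [LHS]As; congr (_ *m diag_mx _ *m _).
  by apply/rowP => k; rewrite !mxE -ge0_Re.
Qed.

Lemma trmx_spmx n (V : 'M[C]_n) d : V *m adjmx V = 1%:M ->
  \tr (spmx V d) = (\sum_k d k)%:C.
Proof.
move=> VV; rewrite mxtrace_mulC mulmxA (mulmx1C VV) mul1mx mxtrace_diag rmorph_sum.
by apply: eq_bigr => k _; rewrite mxE.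
Qed.

End HilbertSpace.

(** * Interpolation of weighted quadratic forms *)

Section Interpolation.
Variable R : realType.
Local Notation C := R[i].

Definition wsq n (q : 'I_n -> R) (a : 'cV[C]_n) : R :=
  \sum_k q k * nsq (a k 0).

(** The rows [c] stay fixed during the interpolation and only the weights [x] move; [rowgram] is the
    matrix of this form. *)
Definition rowsq n (J : finType) (c : J -> 'rV[C]_n) (x : J -> R)
    (a : 'cV[C]_n) : R :=
  \sum_j x j * nsq ((c j *m a) 0 0).

Lemma col_neq0 n (V : 'M[C]_n) k : adjmx V *m V = 1%:M -> col k V != 0.
Proof.
move=> VV; apply/eqP => V0; have := congr1 (fun M : 'M[C]_n => M k k) VV.
rewrite !mxE eqxx big1 => [/esym/eqP|i _]; first by rewrite oner_eq0.
by move/matrixP/(_ i 0): V0; rewrite !mxE => ->; rewrite mulr0.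
Qed.

Lemma spmx_col n (V : 'M[C]_n) d k : adjmx V *m V = 1%:M ->
  spmx V d *m col k V = (d k)%:C *: col k V.
Proof.
move=> VV; rewrite colE /spmx -!mulmxA (mulmxA (adjmx V)) VV mul1mx.
rewrite scalemxAr mul_diag_mx; congr (_ *m _); apply/matrixP => s t.
by rewrite !mxE; case: eqP => [->|_]; rewrite ?mulr0.
Qed.

Lemma qform_le_eigen n (M : 'M[C]_n) : psd M ->
  (forall (v : 'cV[C]_n) (l : R), v != 0 -> M *m v = l%:C *: v -> l <= 1) ->
  forall b : 'cV[C]_n, qform M b <= (\sum_k nsq (b k 0))%:C.
Proof.
move=> Mpsd Meig b; have [V [d [VV d0 Msp]]] := psd_spectral Mpsd.
rewrite Msp qform_spmx ler_cplx -(parseval b VV).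
apply: ler_sum => k _; rewrite ler_piMl ?nsq_ge0 //.
have VV' := mulmx1C VV.
by apply: (Meig (col k V)); rewrite ?col_neq0 // Msp spmx_col.
Qed.

(** This is the expansion of |s z - t w|^2 >= 0 with s, t the square roots of [x0], [x1]. *)
Lemma amgm_Re (x x0 x1 : R) (z w : C) : 0 <= x0 -> 0 <= x1 ->
  x = Num.sqrt (x0 * x1) ->
  2 * (x * Re (z^* * w)) <= x0 * nsq z + x1 * nsq w.
Proof.
move=> x00 x10 ->; rewrite sqrtrM // /nsq.
have := sqr_sqrtr x00; have := sqr_sqrtr x10.
set s := Num.sqrt x0; set t := Num.sqrt x1 => <- <-.
have -> : z^* = conjc z by [].
case: z => a b; case: w => c d /=.
have := sqr_ge0 (s * a - t * c); have := sqr_ge0 (s * b - t * d).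
by move=> h1 h2; rewrite -subr_ge0; apply: le_trans (addr_ge0 h1 h2) _; lra.
Qed.

Lemma wsq_gt0 n (q : 'I_n -> R) a : (forall k, 0 < q k) -> a != 0 -> 0 < wsq q a.
Proof.
move=> q0 a0; rewrite lt_def sumr_ge0 ?andbT; last first.
  by move=> k _; rewrite mulr_ge0 ?nsq_ge0 // ltW.
apply: contra_neq a0 => /eqP; rewrite psumr_eq0; last first.
  by move=> k _; rewrite mulr_ge0 ?nsq_ge0 // ltW.
move/allP => h; apply/matrixP => k l; rewrite ord1 mxE.
have := h k (mem_index_enum _); rewrite /= mulf_eq0 gt_eqF //= nsq_eq0.
by move/eqP.
Qed.

Definition rowgram n (J : finType) (c : J -> 'rV[C]_n) (x : J -> R) : 'M[C]_n :=
  \sum_j (x j)%:C *: (adjmx (c j) *m c j).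

Lemma rowgramE n (J : finType) (c : J -> 'rV[C]_n) x (a b : 'cV[C]_n) :
  (adjmx a *m rowgram c x *m b) 0 0 =
    \sum_j (x j)%:C * (((c j *m a) 0 0)^* * (c j *m b) 0 0).
Proof.
rewrite mulmx_sumr mulmx_suml summxE; apply: eq_bigr => j _.
rewrite -scalemxAr -scalemxAl mxE mulmxA -adjmxM -mulmxA mxE big_ord1.
by rewrite mxE.
Qed.

Lemma qform_rowgram n (J : finType) (c : J -> 'rV[C]_n) x a :
  qform (rowgram c x) a = (rowsq c x a)%:C.
Proof.
rewrite /qform rowgramE rmorph_sum; apply: eq_bigr => j _.
by rewrite rmorphM /= nsqE.
Qed.

(* The bound amounts to all eigenvalues [l] of the Gram form relative to the
   weight [q] being at most 1; for an eigenvector [u] this follows by testing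
   the two endpoint bounds against [(q1 / q) u] and [u], since AM-GM
   bounds the mixed form by their average. *)
Lemma rowsq_midpoint n (J : finType) (c : J -> 'rV[C]_n) (x0 x1 : J -> R)
    (q0 q1 : 'I_n -> R) :
  (forall j, 0 <= x0 j) -> (forall j, 0 <= x1 j) ->
  (forall k, 0 < q0 k) -> (forall k, 0 < q1 k) ->
  (forall a, rowsq c x0 a <= wsq q0 a) ->
  (forall a, rowsq c x1 a <= wsq q1 a) ->
  forall a, rowsq c (fun j => Num.sqrt (x0 j * x1 j)) a <=
            wsq (fun k => Num.sqrt (q0 k * q1 k)) a.
Proof.
move=> x00 x10 q00 q10 h0 h1.
set x := fun j => Num.sqrt _; set q := fun k => Num.sqrt _.
have qgt0 k : 0 < q k by rewrite sqrtr_gt0 mulr_gt0.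
pose r k := Num.sqrt (q k).
have rgt0 k : 0 < r k by rewrite sqrtr_gt0.
have r2 k : r k ^+ 2 = q k by rewrite sqr_sqrtr // ltW.
(* Conjugating by the square root of the weight [q] turns the eigenvalue problem relative to [q]
   into an ordinary one, to which [qform_le_eigen] applies. *)
pose Di : 'M[C]_n := diag_mx (\row_k ((r k)^-1)%:C).
pose D : 'M[C]_n := diag_mx (\row_k (r k)%:C).
have DiD : Di *m D = 1%:M.
  apply/matrixP => i j; rewrite mul_diag_mx !mxE; case: eqP => [_|_]; last first.
    by rewrite !mulr0n mulr0.
  by rewrite !mulr1n -rmorphM /= mulVf ?gt_eqF.
have DDi := mulmx1C DiD.
pose c' j := c j *m Di.
have Mpsd : psd (rowgram c' x).
  move=> v; rewrite -/(qform _ _) qform_rowgram ler_cplx.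
  by apply: sumr_ge0 => j _; rewrite mulr_ge0 ?nsq_ge0 ?sqrtr_ge0.
have Meig (v : 'cV[C]_n) (l : R) :
    v != 0 -> rowgram c' x *m v = l%:C *: v -> l <= 1.
  move=> v0 Mv; pose u := Di *m v.
  have u0 : u != 0.
    by apply: contra_neq v0 => u0; rewrite -[v]mul1mx -DDi -mulmxA -/u u0 mulmx0.
  have vD : v = D *m u by rewrite mulmxA DDi mul1mx.
  clearbody u.
  (* Since q^2 = q0 q1, the factor satisfies q0 (q1 / q)^2 = q1, so both endpoint bounds have
     right-hand side [wsq q1 u]. Since q (q1 / q) = q1, pairing the eigenvalue equation with
     [D *m a] gives [l * wsq q1 u]. *)
  pose a : 'cV[C]_n := \col_k ((q1 k / q k)%:C * u k 0).
  have c'D j w : c' j *m (D *m w) = c j *m w.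
    by rewrite /c' -mulmxA (mulmxA Di) DiD mul1mx.
  have lhs : \sum_j x j * Re (((c j *m a) 0 0)^* * (c j *m u) 0 0) = l * wsq q1 u.
    have := rowgramE c' x (D *m a) v.
    rewrite -mulmxA Mv -scalemxAr mxE => /(congr1 (@complex.Re R)).
    rewrite Re_sum Re_cplxM vD.
    under eq_bigr do rewrite Re_cplxM !c'D.
    move=> <-; congr (_ * _); rewrite mxE Re_sum; apply: eq_bigr => k _.
    rewrite !mul_diag_mx !mxE !rmorphM /= !conjC_real.
    have -> (y z w t : C) : y * (z * w * t) * (y * u k 0) = y ^+ 2 * (z * w) * (t * u k 0).
      by ring.
    rewrite -nsqE; set y := nsq _.
    have -> : (r k)%:C ^+ 2 * ((q1 k)%:C * ((q k)^-1)%:C) * y%:C =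
        (q k * (q1 k / q k) * y)%:C by rewrite -r2 !rmorphM /=; ring.
    by rewrite [q k * _]mulrC divfK ?gt_eqF.
  have upos := wsq_gt0 q10 u0.
  rewrite -(ler_pM2r upos) mul1r -lhs -(@ler_pM2l _ 2) // mulr_sumr.
  have -> : 2 * wsq q1 u = wsq q0 a + wsq q1 u.
    rewrite mulr_natl mulr2n; congr (_ + _); apply: eq_bigr => k _.
    rewrite mxE nsqM nsq_real mulrA; congr (_ * _).
    rewrite expr_div_n [q k ^+ 2]sqr_sqrtr ?mulr_ge0 ?ltW //.
    by field; rewrite !gt_eqF.
  apply: le_trans (lerD (h0 a) (h1 u)).
  rewrite -big_split /=; apply: ler_sum => j _; exact: amgm_Re.
move=> b; have := qform_le_eigen Mpsd Meig (D *m b).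
rewrite qform_rowgram ler_cplx => h.
have -> : rowsq c x b = rowsq c' x (D *m b).
  by apply: eq_bigr => j _; rewrite /c' -mulmxA (mulmxA Di) DiD mul1mx.
apply: le_trans h _; rewrite le_eqVlt; apply/orP; left; apply/eqP.
by apply: eq_bigr => k _; rewrite mul_diag_mx !mxE nsqM nsq_real r2.
Qed.

(** Bisection: [t] is kept between two points of [P] at distance 2^-n, so it is a limit of points of
    [P]. *)
Lemma midpoint_closed_unit_interval (P : R -> Prop) :
  P 0 -> P 1 -> (forall s t, 0 <= s -> s <= t -> t <= 1 -> P s -> P t -> P ((s + t) / 2)) ->
  (forall t, (forall e, 0 < e -> exists2 s, `|t - s| < e & P s) -> P t) ->
  forall t, 0 <= t <= 1 -> P t.
Proof.
move=> P0 P1 Pmid Pcl t /andP[t0 t1]; apply: Pcl => e e0.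
have dy n : exists l u, [/\ P l, P u, 0 <= l <= t, t <= u <= 1 & u - l = 2^-1 ^+ n].
  elim: n => [|n [l [u [Pl Pu /andP[l0 lt] /andP[tu u1] ul]]]].
    by exists 0, 1; split; rewrite ?lexx ?t0 ?t1 ?expr0 ?subr0.
  have lu : l <= u by exact: le_trans tu.
  have Pm := Pmid l u l0 lu u1 Pl Pu.
  rewrite exprS -ul; case: (lerP t ((l + u) / 2)) => tm.
    by exists l, ((l + u) / 2); split => //; [apply/andP; split| apply/andP; split|]; lra.
  by exists ((l + u) / 2), u; split => //; [apply/andP; split| apply/andP; split|]; lra.
have [n ne] : exists n, (2^-1 ^+ n : R) < e.
  exists (Num.bound e^-1); rewrite exprVn invf_plt ?posrE ?exprn_gt0 //.
  exact: upper_nthrootP.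
have [l [u [Pl Pu /andP[l0 lt] /andP[tu u1] ul]]] := dy n.
exists l => //; rewrite ger0_norm ?subr_ge0 //; apply: le_lt_trans ne.
by rewrite -ul lerD2r.
Qed.


Lemma eq_rowsq n (J : finType) (c : J -> 'rV[C]_n) (x y : J -> R) a :
  x =1 y -> rowsq c x a = rowsq c y a.
Proof. by move=> xy; apply: eq_bigr => j _; rewrite xy. Qed.

Lemma eq_wsq n (q r : 'I_n -> R) a : q =1 r -> wsq q a = wsq r a.
Proof. by move=> qr; apply: eq_bigr => k _; rewrite qr. Qed.

(** Geometric interpolation, chosen because the geometric mean of the values at [s] and [t] is the
    value at the midpoint, the form in which [rowsq_midpoint] produces its weights. *)
Definition itp (x y t : R) : R := x `^ (1 - t) * y `^ t.

Lemma itp_gt0 (x y t : R) : 0 < x -> 0 < y -> 0 < itp x y t.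
Proof. by move=> x0 y0; rewrite mulr_gt0 // powR_gt0. Qed.

Lemma sqrt_itp (x y s t : R) : 0 < x -> 0 < y ->
  Num.sqrt (itp x y s * itp x y t) = itp x y ((s + t) / 2).
Proof.
move=> x0 y0; have E (z u v : R) : 0 < z -> z `^ u * z `^ v = (z `^ ((u + v) / 2)) ^+ 2.
  move=> z0; have zn : z != 0 by rewrite gt_eqF.
  by rewrite expr2 -!powRD ?zn ?implybT //; congr (_ `^ _); lra.
rewrite /itp mulrACA !E // -exprMn sqrtr_sqr ger0_norm; last first.
  by rewrite mulr_ge0 ?powR_ge0.
by congr (_ `^ _ * _); lra.
Qed.

Lemma continuous_itp (x y : R) : 0 < x -> 0 < y ->
  continuous (itp x y).
Proof.
move=> x0 y0 t; rewrite /itp /powR !gt_eqF //.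
apply: cvgM.
  apply: (cvg_comp (fun s => (1 - s) * ln x) expR); last exact: continuous_expR.
  by apply: cvgMr_tmp; apply: cvgB; [exact: cvg_cst|exact: cvg_id].
apply: (cvg_comp (fun s => s * ln y) expR); last exact: continuous_expR.
by apply: cvgMr_tmp; exact: cvg_id.
Qed.


Lemma rowsq_itp_gt0 n (J : finType) (c : J -> 'rV[C]_n) (x y : J -> R)
    (q r : 'I_n -> R) :
  (forall j, 0 < x j) -> (forall j, 0 < y j) ->
  (forall k, 0 < q k) -> (forall k, 0 < r k) ->
  (forall a, rowsq c x a <= wsq q a) ->
  (forall a, rowsq c y a <= wsq r a) ->
  forall t, 0 <= t <= 1 -> forall a,
    rowsq c (fun j => itp (x j) (y j) t) a <= wsq (fun k => itp (q k) (r k) t) a.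
Proof.
move=> x0 y0 q0 r0 h0 h1.
have itp0 (u v : R) : 0 < u -> itp u v 0 = u.
  by move=> u0; rewrite /itp subr0 powRr0 mulr1 powRr1 // ltW.
have itp1 (u v : R) : 0 < v -> itp u v 1 = v.
  by move=> v0; rewrite /itp subrr powRr0 mul1r powRr1 // ltW.
apply: midpoint_closed_unit_interval.
- move=> a; rewrite (eq_rowsq c a (fun j => itp0 (x j) (y j) (x0 j))).
  by rewrite (eq_wsq a (fun k => itp0 (q k) (r k) (q0 k))).
- move=> a; rewrite (eq_rowsq c a (fun j => itp1 (x j) (y j) (y0 j))).
  by rewrite (eq_wsq a (fun k => itp1 (q k) (r k) (r0 k))).
- move=> s t _ _ _ hs ht a.
  rewrite (eq_rowsq c a (fun j => esym (sqrt_itp s t (x0 j) (y0 j)))).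
  rewrite (eq_wsq a (fun k => esym (sqrt_itp s t (q0 k) (r0 k)))).
  by apply: rowsq_midpoint => // i; rewrite ?itp_gt0 // ltW // itp_gt0.
(* Closedness: a strict violation at [t] persists in a neighbourhood by continuity, and that
   neighbourhood contains a valid parameter. *)
- move=> t ht a; rewrite leNgt; apply/negP => lt_a.
  pose g s := rowsq c (fun j => itp (x j) (y j) s) a -
              wsq (fun k => itp (q k) (r k) s) a.
  have gc : {for t, continuous g}.
    apply: cvgB; (apply: cvg_big; first exact: add_continuous) => j _;
      by apply: cvgMr_tmp; exact: continuous_itp.
  have gt0 : 0 < g t by rewrite subr_gt0.
  have [e /= e0 He] := @cvgr_gt _ _ _ _ g (g t) gc 0 gt0.
  have [s ts Ps] := ht e e0.
  by have := He s ts; rewrite subr_gt0 ltNge Ps.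
Qed.

Lemma rowsq_itp n (J : finType) (c : J -> 'rV[C]_n) (x y : J -> R)
    (q r : 'I_n -> R) :
  (forall j, 0 <= x j) -> (forall j, 0 <= y j) ->
  (forall k, 0 < q k) -> (forall k, 0 < r k) ->
  (forall a, rowsq c x a <= wsq q a) ->
  (forall a, rowsq c y a <= wsq r a) ->
  forall t, 0 < t < 1 -> forall a,
    rowsq c (fun j => itp (x j) (y j) t) a <= wsq (fun k => itp (q k) (r k) t) a.
Proof.
move=> x0 y0 q0 r0 h0 h1 t /andP[t0 t1] a.
(* Indices where a weight vanishes drop out, as both exponents are positive. *)
pose z j := (x j == 0) || (y j == 0).
pose c' j := if z j then 0 else c j.
pose x' j := if z j then 1 else x j.
pose y' j := if z j then 1 else y j.
have x'0 j : 0 < x' j.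
  rewrite /x' /z; case: eqP => //= xn; case: eqP => //= _.
  by rewrite lt_def x0 andbT; apply/eqP.
have y'0 j : 0 < y' j.
  rewrite /y' /z orbC; case: eqP => //= yn; case: eqP => //= _.
  by rewrite lt_def y0 andbT; apply/eqP.
have sub (w w' : J -> R) b : (forall j, 0 <= w j) -> (forall j, z j = false -> w' j = w j) ->
    rowsq c' w' b <= rowsq c w b.
  move=> w0 ww; apply: ler_sum => j _; rewrite /c'; have := ww j.
  case: (z j) => [_|->] //; rewrite mul0mx mxE nsq0 mulr0.
  by rewrite mulr_ge0 ?nsq_ge0.
have tt : 0 <= t <= 1 by rewrite !ltW.
have h0' b : rowsq c' x' b <= wsq q b.
  by apply: le_trans (h0 b); apply: sub => // j; rewrite /x' => ->.
have h1' b : rowsq c' y' b <= wsq r b.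
  by apply: le_trans (h1 b); apply: sub => // j; rewrite /y' => ->.
apply: le_trans (rowsq_itp_gt0 x'0 y'0 q0 r0 h0' h1' tt a).
apply: ler_sum => j _; rewrite /x' /y' /c' /itp.
case zj: (z j) => //; rewrite [in leRHS]mul0mx [in leRHS]mxE nsq0 mulr0.
by case/orP: zj => /eqP ->; rewrite powR0 ?mulr0 ?mul0r // ?gt_eqF // subr_gt0.
Qed.

End Interpolation.

(** * Tensor products and partial traces *)

Section Tensor.
Variable R : realType.
Local Notation C := R[i].

Lemma sum_mxtens (V : nmodType) m n (f : 'I_(m * n) -> V) :
  \sum_k f k = \sum_i \sum_j f (mxtens_index (i, j)).
Proof.
rewrite pair_bigA /=; apply: reindex => /=.
exists (@mxtens_unindex m n) => k _; last by rewrite -surjective_pairing mxtens_unindexK.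
by rewrite -surjective_pairing mxtens_indexK.
Qed.

Definition ip n (u v : 'cV[C]_n) : C := (adjmx u *m v) 0 0.

Lemma ipE n (u v : 'cV[C]_n) : ip u v = \sum_k (u k 0)^* * v k 0.
Proof. by rewrite /ip mxE; apply: eq_bigr => k _; rewrite mxE. Qed.

Lemma qform_ip n (A : 'M[C]_n) (x : 'cV[C]_n) : qform A x = ip x (A *m x).
Proof. by rewrite /ip mulmxA. Qed.

Lemma ip_conj n (u v : 'cV[C]_n) : (ip u v)^* = ip v u.
Proof.
rewrite !ipE rmorph_sum; apply: eq_bigr => k _.
by rewrite rmorphM /= conjCK mulrC.
Qed.

Lemma nsq_ipC n (u v : 'cV[C]_n) : nsq (ip u v) = nsq (ip v u).
Proof. by rewrite -ip_conj nsq_conj. Qed.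

Lemma ip_col n p (V : 'M[C]_(n, p)) k (x : 'cV[C]_n) :
  ip (col k V) x = (adjmx V *m x) k 0.
Proof. by rewrite ipE mxE; apply: eq_bigr => j _; rewrite !mxE. Qed.

Lemma qform_spmx_ip n (V : 'M[C]_n) d x :
  qform (spmx V d) x = (\sum_k d k * nsq (ip (col k V) x))%:C.
Proof. by rewrite qform_spmx; under eq_bigr do rewrite -ip_col. Qed.

Lemma parseval_ip n (V : 'M[C]_n) (x : 'cV[C]_n) : V *m adjmx V = 1%:M ->
  \sum_k nsq (ip (col k V) x) = \sum_k nsq (x k 0).
Proof. by move=> /(parseval x) <-; under eq_bigr do rewrite ip_col. Qed.

Lemma sum_nsq_col n (V : 'M[C]_n) k : V *m adjmx V = 1%:M ->
  \sum_i nsq ((col k V) i 0) = 1.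
Proof.
move=> VV; apply: cplxI; rewrite -qform1 /qform mulmx1.
by rewrite -/(ip _ _) ip_col colE mulmxA (mulmx1C VV) mul1mx mxE !eqxx.
Qed.

Lemma trmx_qform n (V A : 'M[C]_n) : V *m adjmx V = 1%:M ->
  \tr A = \sum_k qform A (col k V).
Proof.
move=> VV; rewrite -[A in LHS]mulmx1 -VV mulmxA mxtrace_mulC.
apply: eq_bigr => k _; rewrite qform_ip ip_col.
by rewrite [in RHS]colE (mulmxA A) mulmxA -colE [in RHS]mxE.
Qed.

Definition tensv m n (a : 'cV[C]_m) (b : 'cV[C]_n) : 'cV[C]_(m * n) :=
  \col_k (a (mxtens_unindex k).1 0 * b (mxtens_unindex k).2 0).

Lemma tensvE m n (a : 'cV[C]_m) (b : 'cV[C]_n) i j :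
  tensv a b (mxtens_index (i, j)) 0 = a i 0 * b j 0.
Proof. by rewrite mxE mxtens_indexK. Qed.

Lemma col_tens m n (A : 'M[C]_m) (B : 'M[C]_n) i j :
  col (mxtens_index (i, j)) (A *t B) = tensv (col i A) (col j B).
Proof.
by apply/matrixP => k l; rewrite !mxE !mxtens_indexK.
Qed.

Lemma ip_tensv m n (a c : 'cV[C]_m) (b d : 'cV[C]_n) :
  ip (tensv a b) (tensv c d) = ip a c * ip b d.
Proof.
rewrite !ipE sum_mxtens mulr_suml; apply: eq_bigr => i _.
rewrite mulr_sumr; apply: eq_bigr => j _.
by rewrite !tensvE rmorphM /= mulrACA.
Qed.

(** The operator a |-> a (x) b. It makes the overlap of a fixed vector with a (x) b a row vector
    applied to a, as [rowsq] requires. *)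
Definition tensvmx m n (b : 'cV[C]_n) : 'M[C]_(m * n, m) :=
  \matrix_(k, l) ((l == (mxtens_unindex k).1)%:R * b (mxtens_unindex k).2 0).

Lemma tensvmxE m n (a : 'cV[C]_m) (b : 'cV[C]_n) : tensvmx m b *m a = tensv a b.
Proof.
apply/matrixP => k l; rewrite !mxE ord1 (bigD1 (mxtens_unindex k).1) //=.
rewrite mxE eqxx mul1r big1 ?addr0 1?mulrC // => i /negPf ik.
by rewrite mxE ik !mul0r.
Qed.

Lemma tens_scalar1 m n : (1%:M : 'M[C]_m) *t (1%:M : 'M[C]_n) = 1%:M.
Proof.
apply/matrixP => k l; case: (mxtens_indexP k) => i j; case: (mxtens_indexP l) => i' j'.
rewrite tensmxE !mxE -natrM mulnb; congr (_%:R); congr (nat_of_bool _).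
by rewrite (can_eq (@mxtens_indexK m n)) xpair_eqE.
Qed.

Lemma unitary_tens m n (E : 'M[C]_m) (F : 'M[C]_n) :
  E *m adjmx E = 1%:M -> F *m adjmx F = 1%:M ->
  (E *t F) *m adjmx (E *t F) = 1%:M.
Proof. by move=> EE FF; rewrite adjmx_tens tensmx_mul EE FF tens_scalar1. Qed.

Definition tensd m n (d : 'I_m -> R) (e : 'I_n -> R) (k : 'I_(m * n)) : R :=
  d (mxtens_unindex k).1 * e (mxtens_unindex k).2.

Lemma tensdE m n (d : 'I_m -> R) (e : 'I_n -> R) i j :
  tensd d e (mxtens_index (i, j)) = d i * e j.
Proof. by rewrite /tensd mxtens_indexK. Qed.

Lemma spmx_tens m n (E : 'M[C]_m) (F : 'M[C]_n) d e :
  spmx E d *t spmx F e = spmx (E *t F) (tensd d e).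
Proof.
rewrite /spmx adjmx_tens -!tensmx_mul; congr (_ *m _ *m _).
apply/matrixP => k l; case: (mxtens_indexP k) => i j; case: (mxtens_indexP l) => i' j'.
rewrite tensmxE !mxE tensdE (can_eq (@mxtens_indexK m n)) xpair_eqE rmorphM /=.
by case: (i == i'); case: (j == j'); rewrite ?mulr0n ?mulr1n ?mulr0 ?mul0r.
Qed.

Lemma psd_tens m n (A : 'M[C]_m) (B : 'M[C]_n) : psd A -> psd B -> psd (A *t B).
Proof.
move=> /psd_spectral[E [d [_ d0 ->]]] /psd_spectral[F [e [_ e0 ->]]].
by rewrite spmx_tens; apply: psd_spmx => k; rewrite mulr_ge0.
Qed.

Lemma mxtrace_tens m n (A : 'M[C]_m) (B : 'M[C]_n) : \tr (A *t B) = \tr A * \tr B.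
Proof.
rewrite /mxtrace sum_mxtens mulr_suml; apply: eq_bigr => i _.
by rewrite mulr_sumr; apply: eq_bigr => j _; rewrite tensmxE.
Qed.

Definition ptrace2 m n (Z : 'M[C]_(m * n)) : 'M[C]_m :=
  \matrix_(i, j) \sum_s Z (mxtens_index (i, s)) (mxtens_index (j, s)).

Lemma mxtrace_ptrace2 m n (Z : 'M[C]_(m * n)) : \tr (ptrace2 Z) = \tr Z.
Proof. by rewrite /mxtrace sum_mxtens; apply: eq_bigr => i _; rewrite mxE. Qed.

Lemma qformE n (A : 'M[C]_n) x :
  qform A x = \sum_i \sum_j (x i 0)^* * A i j * x j 0.
Proof.
rewrite /qform -mulmxA mxE; apply: eq_bigr => i _; rewrite !mxE mulr_sumr.
by apply: eq_bigr => j _; rewrite mulrA.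
Qed.

Lemma qform_ptrace2 m n (Z : 'M[C]_(m * n)) a :
  qform (ptrace2 Z) a = \sum_s qform Z (tensv a (col s 1%:M)).
Proof.
rewrite qformE; under [RHS]eq_bigr do rewrite qformE sum_mxtens.
rewrite [RHS]exchange_big; apply: eq_bigr => i _ /=.
transitivity (\sum_j \sum_s (a i 0)^* * Z (mxtens_index (i, s)) (mxtens_index (j, s)) * a j 0).
  by apply: eq_bigr => j _; rewrite mxE mulr_sumr mulr_suml.
rewrite exchange_big; apply: eq_bigr => s _ /=.
rewrite (bigD1 s) //= [X in _ + X]big1 ?addr0 => [|t /negPf ts]; last first.
  by apply: big1 => k _; rewrite tensvE !mxE ts mulr0 rmorph0 !mul0r.
rewrite sum_mxtens; apply: eq_bigr => j _.
rewrite (bigD1 s) //= [X in _ + X]big1 ?addr0 => [|t /negPf ts]; last first.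
  by rewrite !tensvE !mxE ts mulr0 mulr0.
by rewrite !tensvE !mxE eqxx !mulr1.
Qed.

(** The partial inner product of [u] with [a] on the first factor, characterized by
    [ip_contract]. *)
Definition contract m n (a : 'cV[C]_m) (u : 'cV[C]_(m * n)) : 'cV[C]_n :=
  \col_s \sum_l (a l 0)^* * u (mxtens_index (l, s)) 0.

Lemma ip_contract m n (a : 'cV[C]_m) (b : 'cV[C]_n) u :
  ip (tensv a b) u = ip b (contract a u).
Proof.
rewrite !ipE sum_mxtens exchange_big; apply: eq_bigr => s _ /=.
rewrite mxE mulr_sumr; apply: eq_bigr => l _.
by rewrite tensvE rmorphM /= mulrAC mulrC !mulrA [_ * (a l 0)^*]mulrC.
Qed.

(** Parseval for the contracted vector. The right-hand side is free of [F], which is why the partial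
    trace can be taken in any orthonormal basis. *)
Lemma sum_ip_tensv m n (F : 'M[C]_n) (a : 'cV[C]_m) u :
  F *m adjmx F = 1%:M ->
  \sum_j nsq (ip u (tensv a (col j F))) = \sum_s nsq (contract a u s 0).
Proof.
move=> /(@parseval_ip _ _ (contract a u)) <-.
by apply: eq_bigr => j _; rewrite nsq_ipC ip_contract.
Qed.

(* The partial trace may be computed in any orthonormal basis [F] of the
   traced-out factor. *)
Lemma qform_ptrace2_spmx m n (U : 'M[C]_(m * n)) z (F : 'M[C]_n) (a : 'cV[C]_m) :
  F *m adjmx F = 1%:M ->
  qform (ptrace2 (spmx U z)) a =
    (\sum_i \sum_j z i * nsq (ip (col i U) (tensv a (col j F))))%:C.
Proof.
move=> FF; rewrite qform_ptrace2.
under eq_bigr do rewrite qform_spmx_ip.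
rewrite -rmorph_sum /= exchange_big /=; congr (_%:C); apply: eq_bigr => i _.
rewrite -!mulr_sumr !sum_ip_tensv //.
by rewrite adjmx1 mulmx1.
Qed.

Lemma psd_ptrace2 m n (Z : 'M[C]_(m * n)) : psd Z -> psd (ptrace2 Z).
Proof.
move=> Zpsd a; rewrite -/(qform _ _) qform_ptrace2.
by apply: sumr_ge0 => s _; apply: Zpsd.
Qed.

End Tensor.

(** * The interpolated partial-trace bound and a Hoelder inequality *)

Section TracePowerBound.
Variable R : realType.
Local Notation C := R[i].

(* Interpolation with parameter [p^-1] between the partial trace of
   [spmx U (y `^ p)] and the bound [\sum_j (b j / c) `^ p <= 1]. *)
Lemma ptrace2_interpolation m n (U : 'M[C]_(m * n)) (y : 'I_(m * n) -> R)
    (F : 'M[C]_n) (b : 'I_n -> R) (W : 'M[C]_m) (w : 'I_m -> R) (p c e : R) a :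
  F *m adjmx F = 1%:M -> W *m adjmx W = 1%:M -> U *m adjmx U = 1%:M ->
  (forall i, 0 <= y i) -> (forall j, 0 <= b j) -> (forall l, 0 <= w l) ->
  1 < p -> 0 < c -> 0 < e ->
  \sum_j b j `^ p <= c `^ p ->
  spmx W w = ptrace2 (spmx U (fun i => y i `^ p)) ->
  \sum_i \sum_j y i `^ (p - 1) * b j * nsq (ip (col i U) (tensv a (col j F))) <=
    c * \sum_l (w l + e) `^ (1 - p^-1) * nsq (ip (col l W) a).
Proof.
move=> FF WW UU y0 b0 w0 p1 c0 e0 bc Ww.
have p0 : 0 < p by apply: lt_trans p1.
(* The variable is expressed in the eigenbasis [W] of the partial trace, so that the form bounding
   the first endpoint is diagonal. *)
pose rw (ij : 'I_(m * n) * 'I_n) : 'rV[C]_m :=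
  adjmx (col ij.1 U) *m tensvmx m (col ij.2 F) *m W.
pose x (ij : 'I_(m * n) * 'I_n) := y ij.1 `^ p.
pose z (ij : 'I_(m * n) * 'I_n) := (b ij.2 / c) `^ p.
have rwE (ij : 'I_(m * n) * 'I_n) (v : 'cV[C]_m) :
    (rw ij *m v) 0 0 = ip (col ij.1 U) (tensv (W *m v) (col ij.2 F)).
  by rewrite /rw -!mulmxA tensvmxE.
have WaE (v : 'cV[C]_m) l : ip (col l W) (W *m v) = v l 0.
  by rewrite ip_col mulmxA (mulmx1C WW) mul1mx.
have h0 v : rowsq rw x v <= wsq (fun l => w l + e) v.
  apply: (@le_trans _ _ (\sum_l w l * nsq (v l 0))); last first.
    by apply: ler_sum => l _; rewrite ler_wpM2r ?nsq_ge0 // lerDl ltW.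
  rewrite le_eqVlt; apply/orP; left; apply/eqP; apply: cplxI.
  transitivity (qform (spmx W w) (W *m v)).
    rewrite Ww (qform_ptrace2_spmx _ _ _ FF) pair_bigA; congr (_%:C).
    by apply: eq_bigr => ij _; rewrite rwE.
  by rewrite qform_spmx_ip; congr (_%:C); apply: eq_bigr => l _; rewrite WaE.
have h1 v : rowsq rw z v <= wsq (fun=> 1) v.
  rewrite /rowsq; under eq_bigr do rewrite rwE.
  rewrite -(pair_bigA _ (fun i j => (b j / c) `^ p *
     nsq (ip (col i U) (tensv (W *m v) (col j F))))) /= exchange_big /=.
  under eq_bigr => j _ do rewrite -mulr_sumr parseval_ip //.
  have E j : \sum_k nsq (tensv (W *m v) (col j F) k 0) = \sum_l nsq (v l 0).
    rewrite sum_mxtens.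
    transitivity (\sum_i nsq ((W *m v) i 0)); last first.
      by rewrite -(parseval_ip (W *m v) WW); under eq_bigr do rewrite WaE.
    apply: eq_bigr => i _.
    under eq_bigr do rewrite tensvE nsqM.
    by rewrite -mulr_sumr (sum_nsq_col j FF) mulr1.
  under eq_bigr do rewrite E.
  rewrite -mulr_suml /wsq; under [in leRHS]eq_bigr do rewrite mul1r.
  rewrite ler_piMl //; first by apply: sumr_ge0 => l _; exact: nsq_ge0.
  under eq_bigr do rewrite powRM ?invr_ge0 ?(ltW c0) //.
  rewrite -mulr_suml -(ler_pM2r (powR_gt0 p c0)) mul1r -mulrA -powRM ?invr_ge0 ?(ltW c0) //.
  by rewrite mulVf ?gt_eqF // powR1 mulr1.
have tt : 0 < p^-1 < 1 by rewrite invr_gt0 p0 invf_lt1.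
have we l : 0 < w l + e by rewrite ltr_wpDl.
have x0 ij : 0 <= x ij by exact: powR_ge0.
have z0 ij : 0 <= z ij by exact: powR_ge0.
have := rowsq_itp x0 z0 we (fun=> ltr01) h0 h1 tt (adjmx W *m a).
have -> : wsq (fun k => itp (w k + e) 1 p^-1) (adjmx W *m a) =
    \sum_l (w l + e) `^ (1 - p^-1) * nsq (ip (col l W) a).
  by apply: eq_bigr => l _; rewrite /itp powR1 mulr1 ip_col.
rewrite -(ler_pM2l c0); apply: le_trans.
rewrite le_eqVlt; apply/orP; left; apply/eqP.
rewrite pair_bigA mulr_sumr; apply: eq_bigr => ij _ /=.
rewrite rwE mulmxA WW mul1mx mulrA; congr (_ * _).
(* At parameter 1/p the weights [y]^ p[and](b / c) [^ p] combine to y^(p-1) (b / c), and the factor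
   [c] cancels the denominator. *)
rewrite /itp /x /z -!powRrM mulfV ?gt_eqF // mulrBr mulr1 mulfV ?gt_eqF //.
by rewrite powRr1 ?divr_ge0 ?(ltW c0) // mulrCA [c * _]mulrC divfK ?gt_eqF.
Qed.

Lemma young_powR (x y t : R) : 0 <= x -> 0 <= y -> 0 < t < 1 ->
  x `^ t * y `^ (1 - t) <= t * x + (1 - t) * y.
Proof.
move=> x0 y0 /andP[t0 t1]; have t1' : 0 < 1 - t by rewrite subr_gt0.
have := @conjugate_powR R (x `^ t) (y `^ (1 - t)) t^-1 (1 - t)^-1.
rewrite !powR_ge0 !invr_gt0 t0 t1' !invrK addrC subrK => /(_ isT isT isT isT erefl).
by rewrite -!powRrM !mulfV ?gt_eqF // !powRr1 // [x * _]mulrC [y * _]mulrC.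
Qed.

(** Hoelder's inequality for the trace of a product, seen from two eigenbases: [mu i l] stands for
    the squared overlap of the i-th and l-th eigenvectors, a doubly stochastic matrix. After
    normalization Young's inequality is applied termwise, and the row and column sums leave 1/p + (1
    - 1/p) = 1. *)
Lemma holder_stochastic m (mu : 'I_m -> 'I_m -> R) (s w : 'I_m -> R) (p : R) :
  (forall i l, 0 <= mu i l) -> (forall i, \sum_l mu i l = 1) ->
  (forall l, \sum_i mu i l = 1) ->
  (forall i, 0 <= s i) -> (forall l, 0 <= w l) -> 1 < p ->
  0 < \sum_i s i `^ p -> 0 < \sum_l w l ->
  \sum_i \sum_l mu i l * (s i * w l `^ (1 - p^-1)) <=
    (\sum_i s i `^ p) `^ p^-1 * (\sum_l w l) `^ (1 - p^-1).
Proof.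
move=> mu0 mu1 mu1' s0 w0 p1; set S := \sum_i _; set W := \sum_l w l => S0 W0.
have p0 : 0 < p by apply: lt_trans p1.
have tt : 0 < p^-1 < 1 by rewrite invr_gt0 p0 invf_lt1.
set K := _ * _; have K0 : 0 < K by rewrite mulr_gt0 ?powR_gt0.
rewrite -(ler_pM2l (_ : 0 < K^-1)) ?invr_gt0 // mulVf ?gt_eqF //.
have term i l : K^-1 * (mu i l * (s i * w l `^ (1 - p^-1))) <=
    mu i l * (p^-1 * (s i `^ p / S) + (1 - p^-1) * (w l / W)).
  rewrite mulrCA ler_wpM2l //.
  have [S0' W0'] := (ltW S0, ltW W0).
  apply: le_trans (young_powR _ _ tt); rewrite ?divr_ge0 ?powR_ge0 //.
  rewrite !powRM ?powR_ge0 ?invr_ge0 // -powRrM mulfV ?gt_eqF // powRr1 //.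
  have V (u t : R) : 0 <= u -> u^-1 `^ t = (u `^ t)^-1.
    by move=> u0; rewrite -powR_inv1 // -powRrM mulN1r powRN.
  by rewrite !V // /K invfM le_eqVlt; apply/orP; left; apply/eqP; ring.
rewrite mulr_sumr; under eq_bigr do rewrite mulr_sumr.
apply: (@le_trans _ _ (\sum_i \sum_l
    mu i l * (p^-1 * (s i `^ p / S) + (1 - p^-1) * (w l / W)))).
  by apply: ler_sum => i _; apply: ler_sum => l _; exact: term.
under eq_bigr do under eq_bigr do rewrite mulrDr.
under eq_bigr do rewrite big_split /= -mulr_suml mu1 mul1r.
rewrite big_split /= [X in _ + X]exchange_big /=.
under [X in _ + X]eq_bigr do rewrite -mulr_suml mu1' mul1r.
rewrite -!mulr_sumr -!mulr_suml !mulfV ?gt_eqF // !mulr1.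
by rewrite addrC subrK.
Qed.

End TracePowerBound.

(** * The trace-power inequality for sums of tensor products *)

Section TracePowerTensor.
Variable R : realType.
Local Notation C := R[i].

Lemma qform_spmx_col n (U : 'M[C]_n) y i : U *m adjmx U = 1%:M ->
  qform (spmx U y) (col i U) = (y i)%:C.
Proof.
move=> UU; rewrite qform_ip (spmx_col _ _ (mulmx1C UU)) ip_col -scalemxAr colE.
by rewrite mulmxA (mulmx1C UU) mul1mx !mxE !eqxx mulr1.
Qed.

Lemma qform_spmx_tens m n (E : 'M[C]_m) (F : 'M[C]_n) d e x :
  qform (spmx E d *t spmx F e) x =
    (\sum_l \sum_j d l * e j * nsq (ip x (tensv (col l E) (col j F))))%:C.
Proof.
rewrite spmx_tens qform_spmx_ip sum_mxtens; congr (_%:C).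
apply: eq_bigr => l _; apply: eq_bigr => j _.
by rewrite tensdE col_tens nsq_ipC.
Qed.

(** Removes the shift by [e] of the [m] eigenvalues of the partial trace, whose sum becomes
    [T + e *+ m]. *)
Lemma le_powR_limit (m : nat) (T K t : R) : 0 < T -> 0 <= K -> 0 <= t <= 1 ->
  (forall e, 0 < e -> T <= K * (T + e *+ m) `^ t) -> T <= K * T `^ t.
Proof.
move=> T0 K0 /andP[t0 t1] h; apply/ler_addgt0Pr => d d0.
pose M := K * T `^ t; have M0 : 0 <= M by rewrite mulr_ge0 ?powR_ge0.
(* [g] makes M g <= d, and [e] makes [e *+ m] at most g T (with [m.+1] to cover m = 0); then (1 +
   g)^t <= 1 + g finishes. *)
pose g := d / (M + 1); have g0 : 0 < g by rewrite divr_gt0 // ltr_wpDl.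
pose e := g * T / m.+1%:R; have e0 : 0 < e by rewrite divr_gt0 // mulr_gt0.
have [T0' g0' e0'] := And3 (ltW T0) (ltW g0) (ltW e0).
apply: le_trans (h e e0) _.
have em : e *+ m <= g * T.
  rewrite -[leRHS](divfK (_ : m.+1%:R != 0)) ?pnatr_eq0 // -/e mulr_natr.
  by rewrite mulrS lerDr ltW.
have Tg : T + e *+ m <= T * (1 + g) by rewrite mulrDr mulr1 lerD2l mulrC.
apply: (@le_trans _ _ (K * (T * (1 + g)) `^ t)).
  rewrite ler_wpM2l // ge0_ler_powR // nnegrE.
    by rewrite addr_ge0 ?mulrn_wge0.
  by rewrite mulr_ge0 ?addr_ge0.
rewrite powRM ?addr_ge0 // mulrA -/M.
apply: (@le_trans _ _ (M * (1 + g))).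
  by rewrite ler_wpM2l // ler1_powR // lerDl ltW.
rewrite mulrDr mulr1 lerD2l /g mulrCA ger_pMr //.
by rewrite ler_pdivrMr ?ltr_wpDl // mul1r lerDl.
Qed.

Lemma sum_powR_tens_le_gt1 (K m n : nat) (E : 'I_K -> 'M[C]_m) (d : 'I_K -> 'I_m -> R)
    (F : 'I_K -> 'M[C]_n) (b : 'I_K -> 'I_n -> R) (U : 'M[C]_(m * n)) y
    (G : 'M[C]_m) s (p c : R) :
  (forall k, F k *m adjmx (F k) = 1%:M) ->
  U *m adjmx U = 1%:M -> G *m adjmx G = 1%:M ->
  (forall k l, 0 <= d k l) -> (forall k j, 0 <= b k j) ->
  (forall i, 0 <= y i) -> (forall i, 0 <= s i) -> 1 < p -> 0 < c ->
  (forall k, \sum_j b k j `^ p <= c `^ p) ->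
  spmx U y = \sum_k spmx (E k) (d k) *t spmx (F k) (b k) ->
  spmx G s = \sum_k spmx (E k) (d k) ->
  \sum_i y i `^ p <= c `^ p * \sum_i s i `^ p.
Proof.
move=> FF UU GG d0 b0 y0 s0 p1 c0 bc Yeq Seq.
have p0 : 0 < p by apply: lt_trans p1.
have [t0 t1] : 0 < p^-1 /\ p^-1 < 1 by rewrite invr_gt0 p0 invf_lt1.
set T := \sum_i y i `^ p; set S := \sum_i s i `^ p.
have S0 : 0 <= S by apply: sumr_ge0 => i _; exact: powR_ge0.
have [->|Tn0] := eqVneq T 0; first by rewrite mulr_ge0 ?powR_ge0.
have T0 : 0 < T.
  by rewrite lt_def Tn0; apply: sumr_ge0 => i _; exact: powR_ge0.
(* The spectral data of Z_1, the partial trace of Y^p; its trace is again [T]. *)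
have [W [w [WW w0 Weq]]] :=
  psd_spectral (psd_ptrace2 (psd_spmx U (fun i => powR_ge0 (y i) p))).
have wT : \sum_l w l = T.
  by apply: cplxI; rewrite -(trmx_spmx w WW) -Weq mxtrace_ptrace2 trmx_spmx.
(* In terms of operators: Tr Y^p <= c Tr (S (Z_1 + e)^(1-1/p)), with S = [spmx G s]. One factor of
   y_i^p = y_i^(p-1) y_i is expanded as the form of Y at its i-th eigenvector, and
   [ptrace2_interpolation] bounds the term of each eigenvector of each A_k. *)
have key e : 0 < e -> T <= c * \sum_i \sum_l
    nsq (ip (col i G) (col l W)) * (s i * (w l + e) `^ (1 - p^-1)).
  move=> e0.
  have yE i : y i = \sum_k \sum_l \sum_j d k l * b k j *
      nsq (ip (col i U) (tensv (col l (E k)) (col j (F k)))).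
    apply: cplxI; rewrite -(qform_spmx_col y i UU) Yeq qform_sum rmorph_sum.
    by apply: eq_bigr => k _; rewrite qform_spmx_tens.
  have -> : T = \sum_k \sum_l d k l * \sum_i \sum_j y i `^ (p - 1) * b k j *
      nsq (ip (col i U) (tensv (col l (E k)) (col j (F k)))).
    transitivity (\sum_i \sum_k \sum_l \sum_j y i `^ (p - 1) * (d k l * b k j *
      nsq (ip (col i U) (tensv (col l (E k)) (col j (F k)))))).
      apply: eq_bigr => i _; rewrite -(mulr_powRB1 (y0 i) p0) mulrC {2}(yE i).
      rewrite mulr_sumr; apply: eq_bigr => k _; rewrite mulr_sumr.
      by apply: eq_bigr => l _; rewrite mulr_sumr.
    rewrite exchange_big; apply: eq_bigr => k _ /=.
    rewrite exchange_big; apply: eq_bigr => l _ /=.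
    rewrite mulr_sumr; apply: eq_bigr => i _; rewrite mulr_sumr.
    by apply: eq_bigr => j _; ring.
  have -> : \sum_i \sum_l nsq (ip (col i G) (col l W)) *
        (s i * (w l + e) `^ (1 - p^-1)) =
      \sum_k \sum_l d k l * \sum_l' (w l' + e) `^ (1 - p^-1) *
        nsq (ip (col l' W) (col l (E k))).
    have sE l : \sum_i s i * nsq (ip (col i G) (col l W)) =
        \sum_k \sum_l' d k l' * nsq (ip (col l' (E k)) (col l W)).
      apply: cplxI; rewrite -qform_spmx_ip Seq qform_sum rmorph_sum.
      by apply: eq_bigr => k _; rewrite qform_spmx_ip.
    rewrite exchange_big.
    transitivity (\sum_l (w l + e) `^ (1 - p^-1) *
        \sum_k \sum_l' d k l' * nsq (ip (col l' (E k)) (col l W))).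
      apply: eq_bigr => l _; rewrite -sE mulr_sumr; apply: eq_bigr => i _; ring.
    under eq_bigr do rewrite mulr_sumr.
    rewrite exchange_big; apply: eq_bigr => k _ /=.
    under eq_bigr do rewrite mulr_sumr.
    rewrite exchange_big; apply: eq_bigr => l _ /=.
    rewrite mulr_sumr; apply: eq_bigr => l' _; rewrite nsq_ipC; ring.
  rewrite mulr_sumr; apply: ler_sum => k _; rewrite mulr_sumr.
  apply: ler_sum => l _; rewrite mulrCA ler_wpM2l //.
  exact: (ptrace2_interpolation _ (FF k) WW UU y0 (b0 k) w0 p1 c0 e0 (bc k) (esym Weq)).
(* [holder_stochastic] requires a positive sum; if it vanishes, all [s i] vanish and [key]
   contradicts T > 0. *)
have [S_eq0|Sn0] := eqVneq S 0.
  have s_eq0 i : s i = 0.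
    apply: (@powR_eq0_eq0 _ _ p); apply/eqP.
    move/eqP: S_eq0; rewrite psumr_eq0 => [/allP/(_ i)|? _]; last exact: powR_ge0.
    by rewrite mem_index_enum => /(_ isT).
  have := key 1 ltr01; rewrite big1 ?mulr0 ?(leNgt T) ?T0 // => i _.
  by rewrite big1 // => l _; rewrite s_eq0 mul0r mulr0.
have Sgt0 : 0 < S by rewrite lt_def Sn0.
have main : T <= c * S `^ p^-1 * T `^ (1 - p^-1).
  apply: (@le_powR_limit m) => //; first by rewrite mulr_ge0 ?powR_ge0 ?ltW.
    by rewrite subr_ge0 gerBl !ltW.
  move=> e e0; apply: le_trans (key e e0) _; rewrite -mulrA ler_wpM2l ?(ltW c0) //.
  have -> : T + e *+ m = \sum_l (w l + e).
    by rewrite big_split /= wT sumr_const card_ord.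
  apply: holder_stochastic => //.
  - by move=> i l; exact: nsq_ge0.
  - move=> i; under eq_bigr do rewrite nsq_ipC.
    by rewrite parseval_ip // sum_nsq_col.
  - by move=> l; rewrite parseval_ip // sum_nsq_col.
  - by move=> l; rewrite addr_ge0 // ltW.
  - rewrite big_split /= wT sumr_const card_ord ltr_wpDr //.
    by rewrite mulrn_wge0 // ltW.
(* Dividing by T^(1-1/p) and raising to the power p turns [main] into the claim. *)
have TE : T = T `^ p^-1 * T `^ (1 - p^-1).
  by rewrite -powRD ?Tn0 ?implybT // [_ + _]addrC subrK powRr1 // ltW.
move: main; rewrite {1}TE ler_pM2r ?powR_gt0 // => main.
have : (T `^ p^-1) `^ p <= (c * S `^ p^-1) `^ p.
  by rewrite ge0_ler_powR ?nnegrE ?mulr_ge0 ?powR_ge0 ?(ltW c0) ?(ltW p0).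
by rewrite powRM ?powR_ge0 ?(ltW c0) // -!powRrM mulVf ?gt_eqF // !powRr1 // ltW.
Qed.

(** For p = 1 both sums are traces, and Tr (A_k (x) B_k) = Tr A_k Tr B_k <= c Tr A_k is summed over
    k. *)
Lemma sum_powR_tens_le (K m n : nat) (E : 'I_K -> 'M[C]_m) (d : 'I_K -> 'I_m -> R)
    (F : 'I_K -> 'M[C]_n) (b : 'I_K -> 'I_n -> R) (U : 'M[C]_(m * n)) y
    (G : 'M[C]_m) s (p c : R) :
  (forall k, E k *m adjmx (E k) = 1%:M) ->
  (forall k, F k *m adjmx (F k) = 1%:M) ->
  U *m adjmx U = 1%:M -> G *m adjmx G = 1%:M ->
  (forall k l, 0 <= d k l) -> (forall k j, 0 <= b k j) ->
  (forall i, 0 <= y i) -> (forall i, 0 <= s i) -> 1 <= p -> 0 < c ->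
  (forall k, \sum_j b k j `^ p <= c `^ p) ->
  spmx U y = \sum_k spmx (E k) (d k) *t spmx (F k) (b k) ->
  spmx G s = \sum_k spmx (E k) (d k) ->
  \sum_i y i `^ p <= c `^ p * \sum_i s i `^ p.
Proof.
move=> EE FF UU GG d0 b0 y0 s0 p1 c0 bc Yeq Seq.
move: p1; rewrite le_eqVlt => /orP[/eqP p1|p1]; last first.
  exact: (sum_powR_tens_le_gt1 FF UU GG d0 b0 y0 s0 p1 c0 bc Yeq Seq).
have E1 (I : finType) (f : I -> R) : (forall i, 0 <= f i) ->
    \sum_i f i `^ p = \sum_i f i.
  by move=> f0; apply: eq_bigr => i _; rewrite -p1 powRr1.
have -> : c `^ p = c by rewrite -p1 powRr1 // ltW.
rewrite !E1 // -ler_cplx rmorphM /= -(trmx_spmx y UU) -(trmx_spmx s GG) Yeq Seq.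
rewrite !raddf_sum /= mulr_sumr; apply: ler_sum => k _.
rewrite mxtrace_tens (trmx_spmx _ (EE k)) (trmx_spmx _ (FF k)) mulrC.
rewrite -!rmorphM /= ler_cplx ler_wpM2r //.
  by apply: sumr_ge0.
by have := bc k; rewrite E1 // -p1 powRr1 // ltW.
Qed.

End TracePowerTensor.

(** * Schatten norms in terms of spectral data *)

Section Schatten.
Variable R : realType.
Local Notation C := R[i].

Lemma char_poly_congr n (V A : 'M[C]_n) : V *m adjmx V = 1%:M ->
  char_poly (V *m A *m adjmx V) = char_poly A.
Proof.
move=> VV; have VVp : map_mx polyC V *m map_mx polyC (adjmx V) = 1%:M.
  by rewrite -map_mxM VV map_mx1.
rewrite /char_poly; have -> : char_poly_mx (V *m A *m adjmx V) =
    map_mx polyC V *m char_poly_mx A *m map_mx polyC (adjmx V).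
  rewrite /char_poly_mx mulmxBr mulmxBl !map_mxM; congr (_ - _).
  by rewrite scalar_mxC -mulmxA VVp mulmx1.
by rewrite !det_mulmx mulrAC -det_mulmx VVp det1 mul1r.
Qed.

(** [eigenvalues] is a chosen list of roots of the characteristic polynomial, so only its multiset
    is determined. *)
Lemma eigenvalues_spmx n (V : 'M[C]_n) d : V *m adjmx V = 1%:M ->
  perm_eq (eigenvalues (spmx V d)) [seq (d k)%:C | k <- index_enum 'I_n].
Proof.
move=> VV; rewrite /eigenvalues; case: closed_field_poly_normal => r /= rE.
apply: prod_XsubC_eq.
move: rE; rewrite (monicP (char_poly_monic _)) scale1r => <-.
rewrite char_poly_congr // char_poly_trig; last first.
  by apply/is_trig_mxP => i j ij; rewrite !mxE -val_eqE ltn_eqF.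
by rewrite big_map; apply: eq_bigr => i _; rewrite !mxE eqxx.
Qed.

Lemma adjmx_spmx n (V : 'M[C]_n) d : adjmx (spmx V d) = spmx V d.
Proof.
rewrite /spmx !adjmxM adjmxK mulmxA; congr (_ *m _ *m _).
apply/matrixP => i j; rewrite !mxE eq_sym; case: eqP => [->|_].
  by rewrite !mulr1n conjC_real.
by rewrite !mulr0n rmorph0.
Qed.

Lemma spmxM n (V : 'M[C]_n) d e : V *m adjmx V = 1%:M ->
  spmx V d *m spmx V e = spmx V (fun k => d k * e k).
Proof.
move=> VV; rewrite /spmx -!mulmxA (mulmxA (adjmx V)) (mulmx1C VV) mul1mx.
rewrite (mulmxA (diag_mx _)) mulmx_diag; congr (_ *m (diag_mx _ *m _)).
by apply/rowP => k; rewrite !mxE rmorphM.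
Qed.

(** The product of the adjoint with the matrix has eigenvalues d_k^2, and nonnegativity gives
    (d_k^2)^(p/2) = d_k^p. *)
Lemma schatten_spmx (p : R) n (V : 'M[C]_n) d : V *m adjmx V = 1%:M ->
  (forall k, 0 <= d k) ->
  schatten p (spmx V d) = (\sum_k d k `^ p) `^ p^-1.
Proof.
move=> VV d0; rewrite /schatten adjmx_spmx spmxM //.
rewrite (perm_big _ (eigenvalues_spmx _ VV)) big_map; congr (_ `^ _).
apply: eq_bigr => k _; rewrite -[Re _]/(d k * d k) -expr2 -powR_mulrn //.
by rewrite -powRrM [2%:R * _]mulrC divfK // pnatr_eq0.
Qed.

Lemma spmx0 n (V : 'M[C]_n) d : (forall k, d k = 0) -> spmx V d = 0.
Proof.
move=> d0; rewrite /spmx (_ : diag_mx _ = 0) ?mulmx0 ?mul0mx //.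
by apply/matrixP => i j; rewrite !mxE d0 mul0rn.
Qed.

Lemma schatten0 (p : R) n : 0 < p -> schatten p (0 : 'M[C]_n) = 0.
Proof.
move=> p0; rewrite -(@spmx0 n 1%:M (fun=> 0)) // schatten_spmx ?adjmx1 ?mulmx1 //.
by rewrite big1 => [|k _]; rewrite powR0 ?invr_eq0 ?gt_eqF.
Qed.

Lemma schatten_ge0 (p : R) n (A : 'M[C]_n) : 0 <= schatten p A.
Proof. exact: powR_ge0. Qed.

Lemma schatten_tens (p : R) m n (A : 'M[C]_m) (B : 'M[C]_n) : psd A -> psd B ->
  schatten p (A *t B) = schatten p A * schatten p B.
Proof.
move=> /psd_spectral[E [d [EE d0 ->]]] /psd_spectral[F [e [FF e0 ->]]].
rewrite spmx_tens !schatten_spmx ?unitary_tens // => [|k]; last by rewrite mulr_ge0.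
rewrite -powRM ?sumr_ge0 // => [|i _|i _]; try exact: powR_ge0.
congr (_ `^ _); rewrite sum_mxtens mulr_suml; apply: eq_bigr => i _.
by rewrite mulr_sumr; apply: eq_bigr => j _; rewrite tensdE powRM.
Qed.

Lemma psdZ n (A : 'M[C]_n) (c : C) : 0 <= c -> psd A -> psd (c *: A).
Proof. by move=> c0 A0 x; rewrite -/(qform _ _) qformZ mulr_ge0 //; apply: A0. Qed.

Lemma psd_sum n (I : finType) (A : I -> 'M[C]_n) :
  (forall i, psd (A i)) -> psd (\sum_i A i).
Proof.
move=> A0 x; rewrite -/(qform _ _) qform_sum.
by apply: sumr_ge0 => i _; apply: A0.
Qed.

Lemma psd_trace_eq0 n (A : 'M[C]_n) : psd A -> \tr A = 0 -> A = 0.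
Proof.
move=> /psd_spectral[V [d [VV d0 ->]]]; rewrite trmx_spmx //.
move=> /(@cplxI _ _ 0)/eqP; rewrite psumr_eq0 // => /allP d_eq0.
by apply: spmx0 => k; apply/eqP/d_eq0; rewrite mem_index_enum.
Qed.

Lemma schatten_tens_sum_le (p : R) (K m n : nat) (A : 'I_K -> 'M[C]_m)
    (B : 'I_K -> 'M[C]_n) c :
  (forall k, psd (A k)) -> (forall k, psd (B k)) -> 1 <= p -> 0 < c ->
  (forall k, schatten p (B k) <= c) ->
  schatten p (\sum_k A k *t B k) <= c * schatten p (\sum_k A k).
Proof.
move=> A0 B0 p1 c0 Bc.
have p0 : 0 < p by apply: lt_le_trans p1.
(* Basis and eigenvalues are packed in a pair so that a single use of [choice] selects both for
   every k. *)
have sp q (X : 'M[C]_q) : psd X -> exists Vd : 'M[C]_q * ('I_q -> R),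
    [/\ Vd.1 *m adjmx Vd.1 = 1%:M, forall k, 0 <= Vd.2 k & X = spmx Vd.1 Vd.2].
  by move=> /psd_spectral[V [d h]]; exists (V, d).
have [E EP] := choice (fun k => sp _ _ (A0 k)).
have [F FP] := choice (fun k => sp _ _ (B0 k)).
have [U [y [UU y0 Yeq]]] := psd_spectral (psd_sum (fun k => psd_tens (A0 k) (B0 k))).
have [G [s [GG s0 Seq]]] := psd_spectral (psd_sum A0).
have bc k : \sum_j (F k).2 j `^ p <= c `^ p.
  have [FF b0 BE] := FP k; have := Bc k; rewrite BE schatten_spmx // => h.
  have S0 : 0 <= \sum_j (F k).2 j `^ p by apply: sumr_ge0 => j _; exact: powR_ge0.
  rewrite -[leLHS](powRr1 S0) -(mulVf (lt0r_neq0 p0)) powRrM.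
  by rewrite ge0_ler_powR ?nnegrE ?powR_ge0 ?(ltW p0) ?(ltW c0).
have := @sum_powR_tens_le R K m n (fun k => (E k).1) (fun k => (E k).2)
  (fun k => (F k).1) (fun k => (F k).2) U y G s p c.
have -> : \sum_k spmx (E k).1 (E k).2 *t spmx (F k).1 (F k).2 = spmx U y.
  by rewrite -Yeq; apply: eq_bigr => k _; case: (EP k) => _ _ <-; case: (FP k) => _ _ <-.
have -> : \sum_k spmx (E k).1 (E k).2 = spmx G s.
  by rewrite -Seq; apply: eq_bigr => k _; case: (EP k) => _ _ <-.
move=> /(_ _ _ UU GG _ _ y0 s0 p1 c0 bc erefl erefl) h.
have {}h : \sum_i y i `^ p <= c `^ p * \sum_i s i `^ p.
  by apply: h => k; [case: (EP k)|case: (FP k)|case: (EP k)|case: (FP k)].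
rewrite Yeq Seq !schatten_spmx //.
have -> : c = (c `^ p) `^ p^-1 by rewrite -powRrM mulfV ?gt_eqF // powRr1 // ltW.
have S0 (q : nat) (f : 'I_q -> R) : 0 <= \sum_i f i `^ p.
  by apply: sumr_ge0 => i _; exact: powR_ge0.
rewrite -powRM ?powR_ge0 // ge0_ler_powR ?nnegrE ?invr_ge0 ?(ltW p0) //.
by rewrite mulr_ge0 ?powR_ge0.
Qed.

(** The eigenvalues lie in [0, 1], so d^p <= d, and they sum to 1. This bounds the set whose
    supremum is [max_pnorm], and absorbs the error term in the theorem. *)
Lemma schatten_density_le1 (p : R) n (A : 'M[C]_n) : density A -> 1 <= p ->
  schatten p A <= 1.
Proof.
move=> [/psd_spectral[V [d [VV d0 ->]]]]; rewrite trmx_spmx // => /(@cplxI _ _ 1) d1 p1.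
have p0 : 0 < p by apply: lt_le_trans p1.
have dle k : d k <= 1.
  by rewrite -d1 (bigD1 k) //= lerDl sumr_ge0.
have -> : 1 = 1 `^ p^-1 :> R by rewrite powR1.
rewrite schatten_spmx // ge0_ler_powR ?nnegrE ?invr_ge0 ?(ltW p0) //.
  by apply: sumr_ge0 => i _; exact: powR_ge0.
rewrite -d1; apply: ler_sum => k _; have := d0 k; rewrite le_eqVlt.
case/orP => [/eqP <-|dk]; first by rewrite powR0 // gt_eqF.
by rewrite ge1r_powR // dk dle.
Qed.

End Schatten.

(** * Channels, maximal p-norms and entanglement breaking maps *)

Section Channels.
Variable R : realType.
Local Notation C := R[i].

Lemma psd_trace_mul_ge0 n (A B : 'M[C]_n) : psd A -> psd B -> 0 <= \tr (A *m B).
Proof.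
move=> A0 /psd_spectral[V [b [VV b0 ->]]]; rewrite (trmx_qform _ VV).
apply: sumr_ge0 => k _; rewrite qform_ip -mulmxA (spmx_col _ _ (mulmx1C VV)).
rewrite /ip -scalemxAr -scalemxAr mxE mulmxA; apply: mulr_ge0; last exact: A0.
by rewrite -[0]/((0 : R)%:C) ler_cplx.
Qed.

Section LinearMap.
Variables (n m : nat) (F : 'M[C]_n -> 'M[C]_m).
Hypothesis Flin : is_linear_map F.

Lemma is_linear_map0 : F 0 = 0.
Proof.
by have /esym/eqP := Flin 1 0 0; rewrite !scale1r addr0 -subr_eq0 addrK => /eqP.
Qed.

Lemma is_linear_mapD X Y : F (X + Y) = F X + F Y.
Proof. by have := Flin 1 X Y; rewrite !scale1r. Qed.

Lemma is_linear_mapZ a X : F (a *: X) = a *: F X.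
Proof. by have := Flin a X 0; rewrite is_linear_map0 !addr0. Qed.

Lemma is_linear_map_sum (I : Type) (r : seq I) (P : pred I) (X : I -> 'M[C]_n) :
  F (\sum_(i <- r | P i) X i) = \sum_(i <- r | P i) F (X i).
Proof. by apply: big_morph; [exact: is_linear_mapD|exact: is_linear_map0]. Qed.

Lemma is_linear_map_delta X : F X = \sum_i \sum_j X i j *: F (delta_mx i j).
Proof.
rewrite {1}[X]matrix_sum_delta is_linear_map_sum; apply: eq_bigr => i _.
by rewrite is_linear_map_sum; apply: eq_bigr => j _; rewrite is_linear_mapZ.
Qed.

End LinearMap.

Section TensorSum.
Variables (m n p q : nat).
Implicit Types (A : 'M[C]_(m, n)) (B : 'M[C]_(p, q)).

Lemma tensmxZl a A B : (a *: A) *t B = a *: (A *t B).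
Proof. by apply/matrixP => i j; rewrite !mxE mulrA. Qed.

Lemma tensmxZr a A B : A *t (a *: B) = a *: (A *t B).
Proof. by apply/matrixP => i j; rewrite !mxE mulrCA. Qed.

Lemma tensmx_suml (I : Type) (r : seq I) (P : pred I) (A : I -> 'M[C]_(m, n)) B :
  (\sum_(i <- r | P i) A i) *t B = \sum_(i <- r | P i) A i *t B.
Proof.
apply: (big_morph (fun A => A *t B)) => [A1 A2|]; last exact: tens0mx.
by apply/matrixP => i j; rewrite !mxE mulrDl.
Qed.

Lemma tensmx_sumr (I : Type) (r : seq I) (P : pred I) A (B : I -> 'M[C]_(p, q)) :
  A *t (\sum_(i <- r | P i) B i) = \sum_(i <- r | P i) A *t B i.
Proof.
apply: (big_morph (fun B => A *t B)) => [B1 B2|]; last exact: tensmx0.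
by apply/matrixP => i j; rewrite !mxE mulrDr.
Qed.

End TensorSum.

Lemma tensmap_tens n1 m1 n2 m2 (F : 'M[C]_n1 -> 'M[C]_m1)
    (G : 'M[C]_n2 -> 'M[C]_m2) A B :
  is_linear_map F -> is_linear_map G -> tensmap F G (A *t B) = F A *t G B.
Proof.
move=> Flin Glin; rewrite (is_linear_map_delta Flin A) (is_linear_map_delta Glin B).
rewrite tensmx_suml; apply: eq_bigr => i _.
rewrite tensmx_suml; apply: eq_bigr => j _.
rewrite tensmx_sumr; apply: eq_bigr => k _.
rewrite tensmx_sumr; apply: eq_bigr => l _.
by rewrite tensmxE tensmxZl tensmxZr scalerA.
Qed.

(** All that boundedness of the supremum requires; [tensmap Phi Om] can thus be treated without
    showing that it is a channel. *)
Definition density_preserving n m (F : 'M[C]_n -> 'M[C]_m) : Prop :=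
  forall rho, density rho -> density (F rho).

Lemma density_tens m n (A : 'M[C]_m) (B : 'M[C]_n) :
  density A -> density B -> density (A *t B).
Proof.
move=> [A0 A1] [B0 B1]; split; first exact: psd_tens.
by rewrite mxtrace_tens A1 B1 mulr1.
Qed.

(** Complete positivity with a one-dimensional ancilla; the tensor factor [1%:M] mediates between
    dimensions [n] and [1 * n]. *)
Lemma channel_psd n m (F : 'M[C]_n -> 'M[C]_m) X : channel F -> psd X -> psd (F X).
Proof.
move=> [Flin Fcp _] X0 x.
have I0 : psd (1%:M : 'M[C]_1).
  by move=> y; rewrite -/(qform _ _) qform1 -[0]/((0 : R)%:C) ler_cplx
    sumr_ge0 // => k _; exact: nsq_ge0.
have id_lin : is_linear_map (fun Y : 'M[C]_1 => Y) by [].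
have := Fcp 1 _ (psd_tens I0 X0) (tensv (const_mx 1) x).
rewrite tensmap_tens // -!/(qform _ _) qform_ip.
have -> : (1%:M *t F X) *m tensv (const_mx 1 : 'cV_1) x =
    tensv (const_mx 1) (F X *m x).
  apply/matrixP => i j; case: (mxtens_indexP i) => i0 i1.
  rewrite (ord1 i0) (ord1 j) tensvE mxE sum_mxtens big_ord1 !mxE mul1r.
  by apply: eq_bigr => k _; rewrite tensmxE tensvE !mxE ord1 !mul1r.
by rewrite ip_tensv qform_ip {1}/ip !mxE big_ord1 !mxE rmorph1 !mul1r.
Qed.

Lemma channel_density n m (F : 'M[C]_n -> 'M[C]_m) :
  channel F -> density_preserving F.
Proof.
move=> Fch rho [rho0 rho1]; split; first exact: channel_psd.
by case: Fch => _ _ /(_ rho) ->.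
Qed.

Section MaxPnorm.
Variables (p : R) (n m : nat) (F : 'M[C]_n -> 'M[C]_m).
Hypothesis p1 : 1 <= p.

Lemma max_pnorm_ge0 : 0 <= max_pnorm p F.
Proof.
rewrite /max_pnorm; set S := (S in sup S).
(* [sup] takes the default value 0 when no supremum exists, for instance on the empty set when n =
   0. *)
have [hS|/sup_out -> //] := pselect (has_sup S).
have [x xS] := hS.1; have x0 : 0 <= x by case: xS => rho _ <-; exact: schatten_ge0.
exact: le_trans x0 (sup_upper_bound hS xS).
Qed.

Lemma max_pnorm_le M : 0 <= M ->
  (forall rho, density rho -> schatten p (F rho) <= M) -> max_pnorm p F <= M.
Proof.
move=> M0 h; rewrite /max_pnorm; set S := (S in sup S).
have [hS|/sup_out -> //] := pselect (has_sup S).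
by apply: ge_sup hS.1 _ => _ [rho rho_d <-]; exact: h.
Qed.

Lemma schatten_le_max_pnorm rho : density_preserving F -> density rho ->
  schatten p (F rho) <= max_pnorm p F.
Proof.
move=> Fd rho_d; apply: ub_le_sup; last by exists rho.
by exists 1 => _ [sigma sigma_d <-]; apply: schatten_density_le1 => //; exact: Fd.
Qed.

End MaxPnorm.

Lemma density_ptrace2 n1 n2 (rho : 'M[C]_(n1 * n2)) :
  density rho -> density (ptrace2 rho).
Proof. by move=> [r0 r1]; split; [exact: psd_ptrace2|rewrite mxtrace_ptrace2]. Qed.

(* [ptrace1 X rho] is the partial trace of [(X *t 1) *m rho] over the first
   factor. *)
Definition ptrace1 n1 n2 (X : 'M[C]_n1) (rho : 'M[C]_(n1 * n2)) : 'M[C]_n2 :=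
  \matrix_(k, l) \sum_i \sum_j
    X j i * rho (mxtens_index (i, k)) (mxtens_index (j, l)).

Lemma mxtrace_ptrace1 n1 n2 (X : 'M[C]_n1) (rho : 'M[C]_(n1 * n2)) :
  \tr (ptrace1 X rho) = \tr (X *m ptrace2 rho).
Proof.
rewrite mxtrace_mulC /mxtrace; under eq_bigr do rewrite mxE.
rewrite exchange_big; apply: eq_bigr => i _; rewrite mxE exchange_big /=.
apply: eq_bigr => j _; rewrite mxE mulr_suml; apply: eq_bigr => k _.
by rewrite mulrC.
Qed.

(** Diagonalizing the measurement operator writes the form as a combination of values of the form of
    [rho] with coefficients [d r], which makes positivity visible. *)
Lemma qform_ptrace1 n1 n2 (V : 'M[C]_n1) d (rho : 'M[C]_(n1 * n2)) x :
  qform (ptrace1 (spmx V d) rho) x =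
    \sum_r (d r)%:C * qform rho (tensv (col r V) x).
Proof.
have E j i : spmx V d j i = \sum_r (d r)%:C * (V j r * (V i r)^*).
  rewrite /spmx mul_mx_diag mxE; apply: eq_bigr => r _.
  by rewrite !mxE mulrAC mulrC.
rewrite qformE.
transitivity (\sum_k \sum_l \sum_i \sum_j \sum_r
    (d r)%:C * ((V i r * x k 0)^* * rho (mxtens_index (i, k)) (mxtens_index (j, l)) *
      (V j r * x l 0))).
  apply: eq_bigr => k _; apply: eq_bigr => l _.
  rewrite mxE mulr_sumr mulr_suml; apply: eq_bigr => i _.
  rewrite mulr_sumr mulr_suml; apply: eq_bigr => j _.
  rewrite E mulr_suml mulr_sumr mulr_suml; apply: eq_bigr => r _.
  by rewrite rmorphM /=; ring.
transitivity (\sum_r \sum_i \sum_k \sum_j \sum_l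
    (d r)%:C * ((V i r * x k 0)^* * rho (mxtens_index (i, k)) (mxtens_index (j, l)) *
      (V j r * x l 0))); last first.
  apply: eq_bigr => r _; rewrite qformE sum_mxtens mulr_sumr.
  apply: eq_bigr => i _; rewrite mulr_sumr; apply: eq_bigr => k _.
  rewrite sum_mxtens mulr_sumr; apply: eq_bigr => j _; rewrite mulr_sumr.
  by apply: eq_bigr => l _; rewrite !tensvE !mxE.
under eq_bigr do under eq_bigr do under eq_bigr do rewrite exchange_big /=.
under eq_bigr do under eq_bigr do rewrite exchange_big /=.
under eq_bigr do rewrite exchange_big /=.
rewrite exchange_big; apply: eq_bigr => r _ /=.
under eq_bigr do rewrite exchange_big /=.
rewrite exchange_big; apply: eq_bigr => i _ /=; apply: eq_bigr => k _ /=.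
exact: exchange_big.
Qed.

Lemma psd_ptrace1 n1 n2 (X : 'M[C]_n1) (rho : 'M[C]_(n1 * n2)) :
  psd X -> psd rho -> psd (ptrace1 X rho).
Proof.
move=> /psd_spectral[V [d [_ d0 ->]]] rho0 x.
rewrite -/(qform _ _) qform_ptrace1; apply: sumr_ge0 => r _.
by rewrite mulr_ge0 ?rho0 // -[0]/((0 : R)%:C) ler_cplx.
Qed.

(** * Entanglement breaking maps tensored with a channel *)

Section EntanglementBreaking.
Variables (n1 m1 K : nat) (Rk : 'I_K -> 'M[C]_m1) (Xk : 'I_K -> 'M[C]_n1).
Variable Phi : 'M[C]_n1 -> 'M[C]_m1.
Hypotheses (Rk_density : forall k, density (Rk k)) (Xk_psd : forall k, psd (Xk k)).
Hypothesis Xk_sum : \sum_(k < K) Xk k = 1%:M.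
Hypothesis PhiE : forall rho, Phi rho = \sum_(k < K) \tr (Xk k *m rho) *: Rk k.

Lemma eb_linear : is_linear_map Phi.
Proof.
move=> a X Y; rewrite !PhiE scaler_sumr -big_split; apply: eq_bigr => k _ /=.
by rewrite mulmxDr -scalemxAr mxtraceD mxtraceZ scalerDl scalerA.
Qed.

(** Outcome k of the measurement on the first factor leaves the unnormalized state
    [ptrace1 (Xk k) rho] on the second. The output is therefore a sum of products, the form that the
    norm inequality exploits. *)
Lemma eb_tensmap n2 m2 (Om : 'M[C]_n2 -> 'M[C]_m2) (rho : 'M[C]_(n1 * n2)) :
  is_linear_map Om ->
  tensmap Phi Om rho = \sum_k Rk k *t Om (ptrace1 (Xk k) rho).
Proof.
move=> Omlin; rewrite /tensmap.
have PhiD i j : Phi (delta_mx i j) = \sum_k Xk k j i *: Rk k.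
  rewrite PhiE; apply: eq_bigr => k _; congr (_ *: _).
  rewrite -(mul_delta_mx (0 : 'I_1)) mulmxA mxtrace_mulC mulmxA -rowE -colE.
  by rewrite trace_mx11 !mxE.
transitivity (\sum_i \sum_j \sum_s \sum_l \sum_k
    (Xk k j i * rho (mxtens_index (i, s)) (mxtens_index (j, l))) *:
      (Rk k *t Om (delta_mx s l))).
  apply: eq_bigr => i _; apply: eq_bigr => j _; apply: eq_bigr => s _.
  apply: eq_bigr => l _; rewrite PhiD tensmx_suml scaler_sumr.
  by apply: eq_bigr => k _; rewrite tensmxZl scalerA mulrC.
transitivity (\sum_k \sum_s \sum_l \sum_i \sum_j
    (Xk k j i * rho (mxtens_index (i, s)) (mxtens_index (j, l))) *:
      (Rk k *t Om (delta_mx s l))); last first.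
  apply: eq_bigr => k _; rewrite (is_linear_map_delta Omlin (ptrace1 _ _)).
  rewrite tensmx_sumr; apply: eq_bigr => s _.
  rewrite tensmx_sumr; apply: eq_bigr => l _.
  rewrite tensmxZr mxE scaler_suml; apply: eq_bigr => i _.
  by rewrite scaler_suml.
under eq_bigr do under eq_bigr do under eq_bigr do rewrite exchange_big /=.
under eq_bigr do under eq_bigr do rewrite exchange_big /=.
under eq_bigr do rewrite exchange_big /=.
rewrite exchange_big; apply: eq_bigr => k _ /=.
under eq_bigr do rewrite exchange_big /=.
rewrite exchange_big; apply: eq_bigr => s _ /=.
under eq_bigr do rewrite exchange_big /=.
exact: exchange_big.
Qed.

Lemma eb_density_preserving : density_preserving Phi.
Proof.
move=> rho [r0 r1].
rewrite PhiE; split.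
  by apply: psd_sum => k; apply: psdZ; [exact: psd_trace_mul_ge0|case: (Rk_density k)].
rewrite raddf_sum /= -r1 -[rho in RHS]mul1mx -Xk_sum mulmx_suml raddf_sum.
by apply: eq_bigr => k _; rewrite mxtraceZ (Rk_density k).2 mulr1.
Qed.

Lemma eb_tensmap_density n2 m2 (Om : 'M[C]_n2 -> 'M[C]_m2) :
  channel Om -> density_preserving (tensmap Phi Om).
Proof.
move=> Omch rho [r0 r1]; have [Omlin _ Omtr] := Omch; rewrite eb_tensmap //; split.
  apply: psd_sum => k; apply: psd_tens; first by case: (Rk_density k).
  by apply: channel_psd => //; exact: psd_ptrace1.
rewrite raddf_sum /=; under eq_bigr => k _ do
  rewrite mxtrace_tens (Rk_density k).2 mul1r Omtr mxtrace_ptrace1.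
by rewrite -r1 -mxtrace_ptrace2 -[ptrace2 rho in RHS]mul1mx -Xk_sum mulmx_suml raddf_sum.
Qed.

(** The outcome probability [x k] is moved onto [Rk k]: the first factors x_k R_k then sum to Phi of
    the marginal, and the second factors are outputs of [Om] on normalized states. *)
Lemma eb_schatten_le (p c : R) n2 m2 (Om : 'M[C]_n2 -> 'M[C]_m2) rho :
  channel Om -> density rho -> 1 <= p -> 0 < c ->
  (forall sigma, density sigma -> schatten p (Om sigma) <= c) ->
  schatten p (tensmap Phi Om rho) <= c * schatten p (Phi (ptrace2 rho)).
Proof.
move=> Omch [r0 r1] p1 c0 Omc; have [Omlin _ Omtr] := Omch.
pose x k := \tr (Xk k *m ptrace2 rho); pose G k := ptrace1 (Xk k) rho.
have G0 k : psd (G k) by exact: psd_ptrace1.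
have x0 k : 0 <= x k by apply: psd_trace_mul_ge0 => //; exact: psd_ptrace2.
have xG k : \tr (G k) = x k by exact: mxtrace_ptrace1.
have Gx0 k : x k = 0 -> G k = 0 by rewrite -xG; exact: psd_trace_eq0.
(* If [x k] is 0 then [G k] is 0 by positivity, and the convention 0^-1 = 0 makes [B k] vanish, so
   the factorization and the norm bound still hold. *)
pose B k := Om ((x k)^-1 *: G k).
have BG k : (x k *: Rk k) *t B k = Rk k *t Om (G k).
  rewrite /B is_linear_mapZ // tensmxZl tensmxZr scalerA.
  have [xk0|xkn0] := eqVneq (x k) 0; last by rewrite mulfV // scale1r.
  by rewrite Gx0 // is_linear_map0 // tensmx0 scaler0.
rewrite eb_tensmap // PhiE.
under eq_bigr do rewrite -/(G _) -BG.
apply: schatten_tens_sum_le => // k.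
- by apply: psdZ => //; case: (Rk_density k).
- by apply: channel_psd => //; apply: psdZ; rewrite ?invr_ge0.
have [xk0|xkn0] := eqVneq (x k) 0; last first.
  apply: Omc; split; first by apply: psdZ; rewrite ?invr_ge0.
  by rewrite mxtraceZ xG mulVf.
by rewrite /B xk0 invr0 scale0r is_linear_map0 // schatten0 ?ltW // (lt_le_trans ltr01).
Qed.

End EntanglementBreaking.

End Channels.

Theorem theorem1 (R : realType) (n1 m1 n2 m2 : nat)
  (Phi : 'M[R[i]]_n1 -> 'M[R[i]]_m1) (Om : 'M[R[i]]_n2 -> 'M[R[i]]_m2) (p : R) :
  entanglement_breaking Phi -> channel Om -> 1 <= p ->
  max_pnorm p (tensmap Phi Om) = max_pnorm p Phi * max_pnorm p Om.
Proof.
move=> [K [Rk [Xk [Rd X0 X1 PhiE]]]] Omch p1.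
have Philin := eb_linear PhiE; have [Omlin _ _] := Omch.
have Phid : density_preserving Phi := eb_density_preserving Rd X0 X1 PhiE.
have Omd : density_preserving Om := channel_density Omch.
have Td : density_preserving (tensmap Phi Om) :=
  eb_tensmap_density Rd X0 X1 PhiE Omch.
have nPhi := max_pnorm_ge0 p Phi; have nOm := max_pnorm_ge0 p Om.
have nT := max_pnorm_ge0 p (tensmap Phi Om).
apply/eqP; rewrite eq_le; apply/andP; split.
  apply: max_pnorm_le => [|rho rd]; first exact: mulr_ge0.
  have rd1 := density_ptrace2 rd.
  (* [eb_schatten_le] asks for a positive constant, while [max_pnorm p Om] may be 0, as for n2 = 0.
     Enlarging it by [e] costs at most [e], since the output of [Phi] has norm at most 1. *)
  apply/ler_addgt0Pr => e e0.
  have c0 : 0 < max_pnorm p Om + e by rewrite ltr_wpDl.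
  apply: le_trans (eb_schatten_le Rd X0 PhiE Omch rd p1 c0 _) _ => [sigma sd|].
    by rewrite (le_trans (schatten_le_max_pnorm p1 Omd sd)) // lerDl ltW.
  rewrite mulrDl lerD //.
    by rewrite mulrC ler_wpM2r // schatten_le_max_pnorm.
  by rewrite ger_pMr // schatten_density_le1 //; exact: Phid.
(* The reverse inequality: product inputs are tested, then the suprema over [sigma] and [rho] are
   taken one after the other by dividing by the other factor, with its zero case treated apart. *)
have le_ab rho sigma : density rho -> density sigma ->
    schatten p (Phi rho) * schatten p (Om sigma) <= max_pnorm p (tensmap Phi Om).
  move=> rd sd; have [[Pr _] [Os _]] := (Phid _ rd, Omd _ sd).
  rewrite -schatten_tens // -tensmap_tens //.
  exact: (schatten_le_max_pnorm p1 Td (density_tens rd sd)).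
have le_a rho : density rho ->
    schatten p (Phi rho) * max_pnorm p Om <= max_pnorm p (tensmap Phi Om).
  move=> rd; have := schatten_ge0 p (Phi rho); rewrite le_eqVlt.
  case/orP => [/eqP <-|a0]; first by rewrite mul0r.
  rewrite mulrC -ler_pdivlMr //; apply: max_pnorm_le => [|sigma sd].
    by rewrite divr_ge0 // ltW.
  by rewrite ler_pdivlMr // mulrC le_ab.
have [->|b_neq0] := eqVneq (max_pnorm p Om) 0; first by rewrite mulr0.
have b0 : 0 < max_pnorm p Om by rewrite lt_def b_neq0.
rewrite -ler_pdivlMr //; apply: max_pnorm_le => [|rho rd].
  by rewrite divr_ge0 // ltW.
by rewrite ler_pdivlMr // le_a.
Qed.
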